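(* Let $(M,g)$ be a compact connected Einstein manifold of dimension $n\ge 2$ with Einstein constant $\alpha>0$ and with positive sectional curvature, and let $\delta>0$ be the minimum of its sectional curvatures (over all tangent $2$-planes at all points of $M$). If $\delta>\alpha/n$, then $(M,g)$ is a spherical space form.
   Context: Manifolds are smooth and without boundary. A connected Riemannian manifold $(M,g)$ of dimension $n\ge 2$ is an Einstein manifold with Einstein constant $\alpha\in\mathbb{R}$ if its Ricci tensor satisfies $\mathrm{Ric}=\alpha\, g$ on $M$ (so that, for example, the unit sphere $\mathbb{S}^n(1)$ has $\alpha=n-1$). A spherical space form is a complete connected Riemannian manifold of constant positive sectional curvature. *)

(* Defs.v *)
From HB Require Import structures.
From mathcomp Require Import all_boot all_order all_algebra.
From mathcomp Require Import all_classical all_reals all_analysis.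
Set Implicit Arguments.
Unset Strict Implicit.
Unset Printing Implicit Defensive.
Import Order.TTheory GRing.Theory Num.Theory.
Import numFieldNormedType.Exports.
Local Open Scope classical_set_scope.
Local Open Scope ring_scope.

(* R^n is 'rV[R]_n; tangent vectors are written in chart coordinates as row
   vectors, so that the differential of F at x acts by v |-> v *m 'J F x. *)

Section Smoothness.
Context {R : realType} {n : nat}.

Definition partial (f : 'rV[R]_n -> R) (i : 'I_n) : 'rV[R]_n -> R :=
  fun x => 'D_(delta_mx 0 i) f x.

(* Only meant for open U, on which the partial derivatives depend on the
   restriction of f to U only. *)
Fixpoint Ck_on (k : nat) (U : set 'rV[R]_n) (f : 'rV[R]_n -> R) : Prop :=
  (forall x, U x -> {for x, continuous f}) /\
  if k is k'.+1 then
    forall i : 'I_n,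
      (forall x, U x -> derivable f x (delta_mx 0 i)) /\
      Ck_on k' U (partial f i)
  else True.

Definition smooth_on (U : set 'rV[R]_n) (f : 'rV[R]_n -> R) : Prop :=
  forall k, Ck_on k U f.

Definition smooth_map_on m (U : set 'rV[R]_n) (F : 'rV[R]_n -> 'rV[R]_m) :=
  forall j, smooth_on U (fun x => F x 0 j).

End Smoothness.

(* A homeomorphism from an open subset of M onto an open subset of R^n. The
   two maps are total functions; their values off chart_dom, resp. off
   chart_img, are irrelevant. *)
Record chart (R : realType) (n : nat) (M : topologicalType) := Chart {
  chart_dom : set M;
  chart_img : set 'rV[R]_n;
  chart_map : M -> 'rV[R]_n;
  chart_inv : 'rV[R]_n -> M;
  chart_dom_open : open chart_dom;
  chart_img_open : open chart_img;
  chart_mapP : forall p, chart_dom p -> chart_img (chart_map p);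
  chart_invP : forall x, chart_img x -> chart_dom (chart_inv x);
  chart_mapK : forall p, chart_dom p -> chart_inv (chart_map p) = p;
  chart_invK : forall x, chart_img x -> chart_map (chart_inv x) = x;
  chart_map_cont : {within chart_dom, continuous chart_map};
  chart_inv_cont : {within chart_img, continuous chart_inv} }.

Section Transition.
Context {R : realType} {n : nat} {M : topologicalType}.

Definition overlap (c d : chart R n M) : set 'rV[R]_n :=
  chart_img c `&` chart_inv c @^-1` chart_dom d.

Definition transition (c d : chart R n M) : 'rV[R]_n -> 'rV[R]_n :=
  chart_map d \o chart_inv c.

End Transition.

(* The smooth structure is given by a smooth atlas, not necessarily maximal. *)
Record smoothManifold (R : realType) (n : nat) := SmoothManifold {
  carrier :> topologicalType;
  mfd_hausdorff : hausdorff_space carrier;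
  mfd_second_countable : @second_countable carrier;
  chart_index : Type;
  mfd_chart : chart_index -> chart R n carrier;
  mfd_cover : forall p : carrier, exists i, chart_dom (mfd_chart i) p;
  mfd_smooth : forall i j,
    smooth_map_on (overlap (mfd_chart i) (mfd_chart j))
                  (transition (mfd_chart i) (mfd_chart j)) }.

(* metric i x is the Gram matrix of g in the coordinate frame of chart i at
   the point of coordinates x; metric_change says that these matrices are the
   local expressions of one and the same (0,2)-tensor field. *)
Record riemannianManifold (R : realType) (n : nat) := RiemannianManifold {
  manifold :> smoothManifold R n;
  metric : chart_index manifold -> 'rV[R]_n -> 'M[R]_n;
  metric_smooth : forall i (a b : 'I_n),
    smooth_on (chart_img (mfd_chart i)) (fun x => metric i x a b);
  metric_sym : forall i x, chart_img (mfd_chart i) x ->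
    (metric i x)^T = metric i x;
  metric_posdef : forall i x (u : 'rV[R]_n), chart_img (mfd_chart i) x ->
    u != 0 -> 0 < (u *m metric i x *m u^T) 0 0;
  metric_change : forall i j x, overlap (mfd_chart i) (mfd_chart j) x ->
    let F := transition (mfd_chart i) (mfd_chart j) in
    metric i x = 'J F x *m metric j (F x) *m ('J F x)^T }.

Section LocalCurvature.
Context {R : realType} {n : nat}.
Variable G : 'rV[R]_n -> 'M[R]_n.

Definition inner (x u v : 'rV[R]_n) : R := (u *m G x *m v^T) 0 0.

(* The component Gamma^k_{ij} of the Levi-Civita connection. *)
Definition christoffel (k i j : 'I_n) (x : 'rV[R]_n) : R :=
  2^-1 * \sum_(l < n) invmx (G x) k l *
    (partial (fun y => G y j l) i x + partial (fun y => G y i l) j x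
     - partial (fun y => G y i j) l x).

(* The component R^l_{ijk}, where R(d_i, d_j) d_k = sum_l R^l_{ijk} d_l and
   R(X, Y) Z = nabla_X nabla_Y Z - nabla_Y nabla_X Z - nabla_[X, Y] Z. *)
Definition riem (l i j k : 'I_n) (x : 'rV[R]_n) : R :=
  partial (christoffel l j k) i x - partial (christoffel l i k) j x
  + \sum_(m < n) (christoffel l i m x * christoffel m j k x
                  - christoffel l j m x * christoffel m i k x).

(* R(u, v) w *)
Definition curvature (x u v w : 'rV[R]_n) : 'rV[R]_n :=
  \row_(l < n) \sum_(i < n) \sum_(j < n) \sum_(k < n)
    u 0 i * v 0 j * w 0 k * riem l i j k x.

(* Ric(Y, Z) = trace of X |-> R(X, Y) Z *)
Definition ricci (x : 'rV[R]_n) : 'M[R]_n :=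
  \matrix_(j < n, k < n) \sum_(i < n) riem i i j k x.

Definition sectional (x u v : 'rV[R]_n) : R :=
  inner x (curvature x u v v) u /
  (inner x u u * inner x v v - inner x u v ^+ 2).

End LocalCurvature.

Section Riemannian.
Context {R : realType} {n : nat}.
Variable M : riemannianManifold R n.

Definition einstein (alpha : R) : Prop :=
  forall i x, chart_img (mfd_chart (s := M) i) x ->
    ricci (metric i) x = alpha *: metric i x.

(* The values of the sectional curvature over all tangent 2-planes at all
   points of M, a 2-plane being given by a basis (u, v). *)
Definition sectional_curvatures : set R :=
  [set k | exists i x u v,
    [/\ chart_img (mfd_chart (s := M) i) x,
        row_free (col_mx u v)
      & k = sectional (metric i) x u v]].

Definition C1_curve (c : R -> 'rV[R]_n) : Prop :=
  (forall t, derivable c t 1) /\ continuous c^`()%classic.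

Definition segment_length i (c : R -> 'rV[R]_n) : R :=
  \int[lebesgue_measure]_(t in `[0, 1])
    Num.sqrt (inner (@metric _ _ M i) (c t) (c^`()%classic t) (c^`()%classic t)).

(* path_length p q l: some piecewise C^1 path from p to q has length l; the
   path is cut into finitely many C^1 pieces that each lie in one chart and
   are parametrized by [0, 1]. *)
Inductive path_length : M -> M -> R -> Prop :=
| path_nil p : path_length p p 0
| path_cons i (c : R -> 'rV[R]_n) q l :
    C1_curve c ->
    (forall t, 0 <= t <= 1 -> chart_img (mfd_chart i) (c t)) ->
    path_length (chart_inv (mfd_chart i) (c 1)) q l ->
    path_length (chart_inv (mfd_chart i) (c 0)) q (segment_length i c + l).

(* +oo if p and q lie in different components *)
Definition riem_dist (p q : M) : \bar R :=
  ereal_inf [set l%:E | l in path_length p q].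

Definition riem_complete : Prop :=
  forall s : nat -> M,
    (forall e : R, 0 < e -> exists N : nat, forall k l : nat,
       (N <= k)%N -> (N <= l)%N -> (riem_dist (s k) (s l) < e%:E)%E) ->
    exists p : M, forall e : R, 0 < e -> exists N : nat, forall k : nat,
       (N <= k)%N -> (riem_dist (s k) p < e%:E)%E.

Definition spherical_space_form : Prop :=
  [/\ riem_complete, connected [set: M] &
      exists2 c : R, 0 < c & forall k, sectional_curvatures k -> k = c].

End Riemannian.

(* Main.v *)
Require Import Defs.
From HB Require Import structures.
From mathcomp Require Import all_boot all_order all_algebra.
From mathcomp Require Import all_classical all_reals all_analysis.
From mathcomp Require Import ring lra.
Set Implicit Arguments.
Unset Strict Implicit.
Unset Printing Implicit Defensive.
Import Order.TTheory GRing.Theory Num.Theory.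
Import numFieldNormedType.Exports.
Local Open Scope classical_set_scope.
Local Open Scope ring_scope.

(** Let T be the curvature tensor of g minus delta times the tensor of constant
sectional curvature 1.  Then T(x, y, y, x) >= 0 for all x and y, with equality
when x, y span a plane of minimal curvature, and the Einstein condition says that
the trace of T is tau g with tau = alpha - (n - 1) delta.  The hypothesis
delta > alpha / n is precisely tau < delta.  The whole point is to show that
tau = 0: then for each y the form T(., y, y, .) is positive semidefinite of trace
zero, hence T(x, y, y, x) = 0 everywhere, and the sectional curvature is the
constant delta ([zero_trace_flat], [constant_of_trace0]).

To get tau = 0, let u, v be an orthonormal basis of a plane of minimal curvature
at a point x0.  Extend u and v to fields X and Y whose covariant derivative
vanishes at x0.  The function T(X, Y, Y, X) is nonnegative and vanishes at x0, so
its second derivatives there are nonnegative; since T(u, v, v, .) and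
T(v, u, u, .) vanish, by positivity, these second derivatives are the values at
(u, v, v, u) of the second covariant derivative of T ([hess_ge0_at_min]).  So
the Laplacian of the curvature is nonnegative at (u, v, v, u).  On the other
hand the curvature of an Einstein metric is divergence free, and the second
Bianchi identity and the Ricci identity turn this Laplacian into
   - 2 delta tau - 2 tr(N P) + sum over a, b of
       4 D(a, b) D(b, a) - D(a, b)^2 - D(b, a)^2,
where N = T(u, ., ., u), P = T(v, ., ., v), D = T(u, ., ., v)
([laplacian_zero_plane]).  As N and P are positive semidefinite, tr(N P) >= 0; and
the positivity of T on planes containing a combination of u and v bounds
(D(x, y) + D(y, x))^2 by (N + P)(x, x) (N + P)(y, y), so the last sum is at most
(tr(N + P))^2 / 2 = 2 tau^2.  Hence 0 <= - 2 delta tau + 2 tau^2, and tau = 0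
because 0 <= tau < delta ([trace_eq0_of_pinching]).

Everything above happens in one chart.  The tensor calculus (both Bianchi
identities, the Ricci identity, traces) is carried out over an arbitrary
commutative ring with commuting derivations.  It is then applied to the ring of
smooth functions on the image of a chart and evaluated at a point, which gives
the curvature written with Christoffel symbols.

Completeness follows from compactness: a Cauchy sequence has a cluster point, and
points close to it are joined to it by short straight segments in a chart. *)

(** * Algebraic curvature tensors *)

Lemma discriminant_le (R : realFieldType) (a b c : R) :
  0 <= a -> (forall t, 0 <= a * t ^+ 2 + 2 * b * t + c) -> b ^+ 2 <= a * c.
Proof.
move=> a0 h; have [a_eq0|a_neq0] := eqVneq a 0.
  have [->|b0] := eqVneq b 0; first by rewrite a_eq0 mul0r expr0n.
  have := h (- (c + 1) / (2 * b)).
  rewrite a_eq0 mul0r add0r.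
  have -> : 2 * b * (- (c + 1) / (2 * b)) = - (c + 1) by field.
  lra.
have ap : 0 < a by rewrite lt_neqAle eq_sym a_neq0.
have := h (- b / a).
have -> : a * (- b / a) ^+ 2 + 2 * b * (- b / a) + c = (a * c - b ^+ 2) / a by field.
by rewrite pmulr_lge0 ?invr_gt0// subr_ge0.
Qed.

(** Used as a first order condition: if c t^2 + 2 b t is the variation of a
nonnegative quantity about one of its zeros, then the first variation b is zero. *)
Lemma linear_ge0_eq0 (R : realFieldType) (b c : R) :
  (forall t, 0 <= c * t ^+ 2 + 2 * b * t) -> b = 0.
Proof.
move=> h; have c0 : 0 <= c by have := h 1; have := h (-1); lra.
apply/eqP; rewrite -sqrf_eq0 eq_le sqr_ge0 andbT -(mulr0 c).
by apply: discriminant_le => // t; rewrite addr0.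
Qed.

Section Multilinear.
Variables (A : comNzRingType) (V : lmodType A).

(** Linearity is a predicate on bare functions, so that it applies directly to a
multilinear map with all its arguments but one fixed. *)
Definition lin1 (f : V -> A) := forall a x y, f (a *: x + y) = a * f x + f y.

Definition bilin (B : V -> V -> A) :=
  (forall y, lin1 (B^~ y)) /\ (forall x, lin1 (B x)).

Record mlin4 (T : V -> V -> V -> V -> A) : Prop := Mlin4 {
  mlin4_1 : forall y z w, lin1 (fun x => T x y z w);
  mlin4_2 : forall x z w, lin1 (fun y => T x y z w);
  mlin4_3 : forall x y w, lin1 (fun z => T x y z w);
  mlin4_4 : forall x y z, lin1 (fun w => T x y z w) }.

Record curv_sym (T : V -> V -> V -> V -> A) : Prop := CurvSym {
  curv_skew12 : forall x y z w, T y x z w = - T x y z w;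
  curv_skew34 : forall x y z w, T x y w z = - T x y z w;
  curv_bianchi : forall x y z w, T x y z w + T y z x w + T z x y w = 0 }.

Section Lin1.
Variables (f : V -> A) (fL : lin1 f).

Lemma lin1_0 : f 0 = 0.
Proof.
by have := fL 1 0 0; rewrite scaler0 addr0 mul1r -[X in X = _]addr0 => /addrI.
Qed.

Lemma lin1D x y : f (x + y) = f x + f y.
Proof. by rewrite -[x in LHS]scale1r fL mul1r. Qed.

Lemma lin1Z a x : f (a *: x) = a * f x.
Proof. by rewrite -[a *: x]addr0 fL lin1_0 addr0. Qed.

Lemma lin1N x : f (- x) = - f x.
Proof. by rewrite -scaleN1r lin1Z mulN1r. Qed.

Lemma lin1B x y : f (x - y) = f x - f y.
Proof. by rewrite lin1D lin1N. Qed.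

Lemma lin1_sum I (r : seq I) P (F : I -> V) :
  f (\sum_(i <- r | P i) F i) = \sum_(i <- r | P i) f (F i).
Proof. exact: (big_morph f lin1D lin1_0). Qed.

End Lin1.

(** Adding the four instances of the Bianchi identity with each of x, y, z, w in turn
in the last slot leaves twice the difference of the two sides. *)
Lemma curv_pair T : (forall a : A, a + a = 0 -> a = 0) -> curv_sym T ->
  forall x y z w, T z w x y = T x y z w.
Proof.
move=> tor [s12 s34 b] x y z w; apply/eqP; rewrite -subr_eq0; apply/eqP/tor.
have sum0 : T w x z y + T x z w y + T z w x y + (T x z y w + T z y x w + T y x z w)
    + (T z y w x + T y w z x + T w z y x) + (T y w x z + T w x y z + T x y w z) = 0.
  by rewrite !b !addr0.
rewrite -[RHS]sum0 (s34 w x z y) (s34 x z y w) (s34 z y x w) (s34 y w x z).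
by rewrite (s12 z w y x) (s34 z w x y) (s12 x y z w) (s34 x y z w); ring.
Qed.

Definition const_curv (B : V -> V -> A) (x y z w : V) : A :=
  B y z * B x w - B x z * B y w.

Lemma mlin4_shift k B T : bilin B -> mlin4 T ->
  mlin4 (fun x y z w => T x y z w + k * const_curv B x y z w).
Proof.
move=> [b1 b2] [t1 t2 t3 t4].
have {}b1 p a u v : B (a *: u + v) p = a * B u p + B v p := b1 p a u v.
have {}b2 p a u v : B p (a *: u + v) = a * B p u + B p v := b2 p a u v.
split=> p q r a u v; rewrite /const_curv.
- by rewrite t1 !b1; ring.
- by rewrite t2 !b1; ring.
- by rewrite t3 !b2; ring.
- by rewrite t4 !b2; ring.
Qed.

Lemma curv_sym_shift k B T : (forall x y, B x y = B y x) -> curv_sym T ->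
  curv_sym (fun x y z w => T x y z w + k * const_curv B x y z w).
Proof.
move=> BC [s12 s34 b]; split=> x y z w; rewrite /const_curv.
- by rewrite s12; ring.
- by rewrite s34; ring.
- by rewrite -[RHS](b x y z w) (BC y x) (BC z x) (BC z y); ring.
Qed.

End Multilinear.

Section Cholesky.
Variable R : rcfType.

Definition qform n (M : 'M[R]_n) (x : 'rV[R]_n) : R := (x *m M *m x^T) 0 0.

(** By induction on the size, completing the square in the first variable.  When
the top left entry a is 0, positivity forces the rest of the first row to vanish,
and the convention 0^-1 = 0 makes the same formulas apply. *)
Lemma cholesky n (M : 'M[R]_n) : M^T = M -> (forall x, 0 <= qform M x) ->
  exists L : 'M[R]_n, M = L *m L^T.
Proof.
elim: n M => [|n IH]; first by move=> M _ _; exists 0; apply/matrixP => -[].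
rewrite -[n.+1]/(1 + n)%N => M symM psdM.
pose a := ulsubmx M 0 0; pose b := ursubmx M; pose C := drsubmx M.
have eqM : M = block_mx a%:M b b^T C.
  rewrite -[LHS]submxK; congr block_mx; last by rewrite /b trmx_ursub symM.
  by rewrite [LHS]mx11_scalar.
have symC : C^T = C by rewrite /C trmx_drsub symM.
pose f s y : R := qform M (row_mx s%:M y).
have fE s y : f s y = a * s ^+ 2 + 2 * (b *m y^T) 0 0 * s + (y *m C *m y^T) 0 0.
  have eq_by : (y *m b^T) 0 0 = (b *m y^T) 0 0.
    by rewrite -[y *m b^T]trmxK trmx_mul trmxK mxE.
  rewrite /f /qform eqM mul_row_block tr_row_mx mul_row_col tr_scalar_mx.
  rewrite !mulmxDl !mul_scalar_mx !mul_mx_scalar -scalemxAl.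
  have mxD2 (X Y : 'M[R]_1) : (X + Y) 0 0 = X 0 0 + Y 0 0 by rewrite mxE.
  have mxZ2 k (X : 'M[R]_1) : (k *: X) 0 0 = k * X 0 0 by rewrite mxE.
  rewrite !(mxD2, mxZ2) eq_by [in X in X + _]mxE eqxx.
  by rewrite !mulr1n; ring.
have a_ge0 : 0 <= a.
  by have := psdM (row_mx 1%:M 0); rewrite -/(f _ _) fE trmx0 !mulmx0 ![(0 : 'M[R]_1) _ _]mxE; lra.
have b0 : a = 0 -> b = 0.
  move=> a_eq0; apply: (can_inj trmxK); rewrite trmx0.
  apply/matrixP => i j; rewrite ord1 [RHS]mxE.
  pose y : 'rV[R]_n := delta_mx 0 i.
  have -> : b^T i 0 = (b *m y^T) 0 0.
    by rewrite /y trmx_delta -colE !mxE.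
  apply: (@linear_ge0_eq0 _ _ ((y *m C *m y^T) 0 0)) => t.
  have := psdM (row_mx 1%:M (t *: y)); rewrite -/(f _ _) fE a_eq0 mul0r add0r.
  by rewrite linearZ /= -!scalemxAr -!scalemxAl !mxE; lra.
(* The Schur complement of a; the form of C' at y is the value of M at the
   minimizer in the first variable, s = - b y / a. *)
pose C' := C - a^-1 *: (b^T *m b).
have [||L' eqC'] := IH C'.
- by rewrite /C' linearB linearZ /= symC trmx_mul trmxK.
- move=> y; rewrite /qform /C' mulmxBr mulmxBl -scalemxAr -scalemxAl.
  set q := (b *m y^T) 0 0.
  have -> : y *m (b^T *m b) *m y^T = (q * q)%:M.
    have -> : y *m (b^T *m b) *m y^T = (b *m y^T)^T *m (b *m y^T).
      by rewrite trmx_mul trmxK !mulmxA.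
    by rewrite [b *m y^T]mx11_scalar -/q tr_scalar_mx -scalar_mxM.
  have := psdM (row_mx (- a^-1 * q)%:M y); rewrite -/(f _ _) fE -/q.
  have [a_eq0|a_neq0] := eqVneq a 0.
    by rewrite a_eq0 !invr0 [in X in _ -> X]mxE scale0r !mxE; lra.
  rewrite [in X in _ -> X]mxE; set z := (y *m C *m y^T) 0 0; rewrite !mxE eqxx.
  have -> : a * (- a^-1 * q) ^+ 2 + 2 * q * (- a^-1 * q) = - (a^-1 * (q * q)).
    by field.
  by rewrite mulr1n addrC.
exists (block_mx (Num.sqrt a)%:M 0 ((Num.sqrt a)^-1 *: b^T) L').
rewrite tr_block_mx mulmx_block !trmx0 !mulmx0 mul0mx !addr0 eqM.
rewrite tr_scalar_mx -scalar_mxM -expr2 sqr_sqrtr// linearZ /= trmxK.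
rewrite mul_scalar_mx mul_mx_scalar !scalerA -scalemxAl -scalemxAr scalerA.
rewrite -eqC' /C'.
have [a_eq0|a_neq0] := eqVneq a 0.
  by rewrite (b0 a_eq0) trmx0 !(mul0mx, scaler0) subr0 add0r.
have sa : Num.sqrt a != 0 by rewrite gt_eqF// sqrtr_gt0 lt_neqAle eq_sym a_neq0.
by rewrite divff// !scale1r -invfM -expr2 sqr_sqrtr// addrC subrK.
Qed.
End Cholesky.

Lemma unit_posdef (R : rcfType) n (M : 'M[R]_n) :
  (forall u : 'rV[R]_n, u != 0 -> 0 < (u *m M *m u^T) 0 0) -> M \in unitmx.
Proof.
move=> pos; rewrite -row_free_unit -kermx_eq0; apply/rowV0P => u /sub_kermxP uM.
apply/eqP; rewrite -[_ == _]negbK; apply/negP => /pos.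
by rewrite uM mul0mx mxE ltxx.
Qed.

Section OrthonormalFrame.
Context {R : rcfType} {n : nat} (M : 'M[R]_n).
Hypothesis symM : M^T = M.
Hypothesis posM : forall u : 'rV[R]_n, u != 0 -> 0 < (u *m M *m u^T) 0 0.

(** The rows of the inverse of a Cholesky factor of M are orthonormal for M.  The
third property identifies the metric trace computed with the inverse Gram matrix
in the coordinate basis with the trace over the orthonormal frame: the first one
is what differentiates well, the second one is what inequalities need. *)
Lemma orthonormal_frame : exists E : 'I_n -> 'rV[R]_n,
  [/\ forall x, x = \sum_a (x *m M *m (E a)^T) 0 0 *: E a,
      forall a, (E a *m M *m (E a)^T) 0 0 = 1 &
      forall F : 'rV[R]_n -> 'rV[R]_n -> R, bilin F ->
        \sum_i \sum_l invmx M i l * F (delta_mx 0 i) (delta_mx 0 l) =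
        \sum_a F (E a) (E a)].
Proof.
have [|L ML] := cholesky symM.
  move=> x; have [->|/posM/ltW//] := eqVneq x 0.
  by rewrite /qform !mul0mx mxE.
have Mu := unit_posdef posM.
have Lu : L \in unitmx by move: Mu; rewrite ML unitmx_mul => /andP[].
pose B := invmx L; have BMB : B *m M *m B^T = 1%:M.
  by rewrite ML /B mulKmx// trmx_inv mulmxV// unitmx_tr.
have MBB : M *m (B^T *m B) = 1%:M.
  by rewrite mulmxA; apply: mulmx1C; rewrite mulmxA.
have BB : invmx M = B^T *m B by rewrite -[LHS]mulmx1 -MBB mulKmx.
exists (fun a => row a B); split.
- move=> x; rewrite -{1}[x]mulmx1 -MBB !mulmxA mulmx_sum_row.
  apply: eq_bigr => a _; congr (_ *: _).
  by rewrite tr_row colE mulmxA -colE [RHS]mxE.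
- move=> a; have /matrixP/(_ a a) := BMB; rewrite [RHS]mxE eqxx => BMBa.
  apply: etrans BMBa.
  by rewrite tr_row colE mulmxA -colE -!row_mul [LHS]mxE [LHS]mxE.
- move=> F [F1 F2]; rewrite BB.
  transitivity (\sum_i \sum_l \sum_a B a i * B a l * F (delta_mx 0 i) (delta_mx 0 l)).
    apply: eq_bigr => i _; apply: eq_bigr => l _; rewrite mxE mulr_suml.
    by apply: eq_bigr => a _; rewrite mxE.
  under eq_bigr => i _ do rewrite exchange_big.
  rewrite exchange_big; apply: eq_bigr => a _ /=.
  rewrite [row a B]row_sum_delta (lin1_sum (F1 _)); apply: eq_bigr => i _.
  rewrite (lin1Z (F1 _)) (lin1_sum (F2 _)) mulr_sumr; apply: eq_bigr => l _.
  by rewrite (lin1Z (F2 _)) !mxE mulrA.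
Qed.

End OrthonormalFrame.

Section Frame.
Variables (R : rcfType) (V : lmodType R) (g : V -> V -> R) (n : nat).
Variables (e : 'I_n -> V).
Hypothesis frame : forall x, x = \sum_a g x (e a) *: e a.

Lemma frame_sum (f : V -> R) x : lin1 f -> \sum_a g x (e a) * f (e a) = f x.
Proof.
move=> fL; rewrite [in RHS](frame x) lin1_sum//.
by apply: eq_bigr => a _; rewrite lin1Z.
Qed.

(** Writing N = L L^T, this trace of a product is the sum of the values of P on the
columns of L. *)
Lemma psd_frame_pair (N P : V -> V -> R) : bilin N -> bilin P ->
    (forall x y, N x y = N y x) -> (forall x, 0 <= N x x) ->
    (forall x, 0 <= P x x) ->
  0 <= \sum_a \sum_b N (e a) (e b) * P (e a) (e b).
Proof.
move=> [N1 N2] [P1 P2] Nsym Npsd Ppsd.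
have bsum (B : V -> V -> R) (c : 'I_n -> R) : bilin B ->
    B (\sum_a c a *: e a) (\sum_a c a *: e a) =
    \sum_a \sum_b c a * c b * B (e a) (e b).
  move=> [B1 B2]; rewrite (lin1_sum (B1 _)); apply: eq_bigr => a _.
  rewrite (lin1Z (B1 _)) (lin1_sum (B2 _)) mulr_sumr; apply: eq_bigr => b _.
  by rewrite (lin1Z (B2 _)) mulrA.
have [||L eqL] := @cholesky R n (\matrix_(a, b) N (e a) (e b)).
- by apply/matrixP => a b; rewrite !mxE.
- move=> x; rewrite /qform; have := Npsd (\sum_a x 0 a *: e a).
  rewrite bsum//; congr (_ <= _).
  rewrite !mxE exchange_big; apply: eq_bigr => b _; rewrite !mxE mulr_suml.
  by apply: eq_bigr => a _; rewrite !mxE; ring.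
have NE a b : N (e a) (e b) = \sum_k L a k * L b k.
  have /matrixP/(_ a b) := eqL; rewrite !mxE => ->.
  by apply: eq_bigr => k _; rewrite mxE.
suff -> : \sum_a \sum_b N (e a) (e b) * P (e a) (e b) =
    \sum_k P (\sum_a L a k *: e a) (\sum_a L a k *: e a).
  by apply: sumr_ge0 => k _.
rewrite (eq_bigr _ (fun k _ => bsum P (L^~ k) (conj P1 P2))) [RHS]exchange_big.
apply: eq_bigr => a _; rewrite [RHS]exchange_big; apply: eq_bigr => b _.
by rewrite NE mulr_suml.
Qed.

(** T stands for the curvature tensor minus delta times the one of constant
curvature 1 and R0 for the curvature tensor itself, at a given point; H p q stands
for the second covariant derivative of either in the directions p, q. *)
Section Core.
Hypothesis gC : forall x y, g x y = g y x.
Variables (T : V -> V -> V -> V -> R) (H : V -> V -> V -> V -> V -> V -> R).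
Variables (delta tau : R).
Hypothesis TL : mlin4 T.
Hypothesis Tcurv : curv_sym T.
Hypothesis Ttrace : forall y z, \sum_a T (e a) y z (e a) = tau * g y z.
Hypothesis Tpos : forall x y, 0 <= T x y y x.
Hypothesis Hcurv : forall p q, curv_sym (H p q).
Hypothesis Htrace : forall p q y z, \sum_a H p q (e a) y z (e a) = 0.
Hypothesis Hbianchi : forall p a x y z w,
  H p a x y z w + H p x y a z w + H p y a x z w = 0.
Let R0 x y z w := T x y z w + delta * const_curv g x y z w.
Hypothesis Hricci : forall p q x y z w, H p q x y z w - H q p x y z w =
  - \sum_m (R0 p q x (e m) * T (e m) y z w + R0 p q y (e m) * T x (e m) z w +
            R0 p q z (e m) * T x y (e m) w + R0 p q w (e m) * T x y z (e m)).

Lemma real_addrr_eq0 (a : R) : a + a = 0 -> a = 0.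
Proof. lra. Qed.

Let Tpair := curv_pair real_addrr_eq0 Tcurv.
Let T12 := curv_skew12 Tcurv.
Let T34 := curv_skew34 Tcurv.

Lemma curv_diag12 (S : V -> V -> V -> V -> R) x z w : curv_sym S -> S x x z w = 0.
Proof. by move=> SC; apply: real_addrr_eq0; rewrite {1}(curv_skew12 SC) addNr. Qed.

Lemma curv_diag34 (S : V -> V -> V -> V -> R) x z w : curv_sym S -> S z w x x = 0.
Proof. by move=> SC; apply: real_addrr_eq0; rewrite {1}(curv_skew34 SC) addNr. Qed.

(** The vector x minimizes the nonnegative quadratic form T(., y, y, .), so the
first variation of this form at x vanishes. *)
Lemma zero_plane_contract x y z : T x y y x = 0 -> T x y y z = 0.
Proof.
move=> Txy; apply: (@linear_ge0_eq0 _ _ (T z y y z)) => t.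
have := Tpos (t *: z + x) y.
rewrite (mlin4_1 TL) !(mlin4_4 TL) Txy (Tpair y x z y) (T12 x y z y)
  (T34 x y y z) opprK.
by congr (_ <= _); ring.
Qed.

(** For fixed y, each diagonal entry T(e_a, y, y, e_a) is nonnegative and they add
up to zero, so they all vanish; [zero_plane_contract] then kills the others. *)
Lemma zero_trace_flat : tau = 0 -> forall x y, T x y y x = 0.
Proof.
move=> tau0 x y.
have Te a : T (e a) y y (e a) = 0.
  have := Ttrace y y; rewrite tau0 mul0r => /eqP.
  rewrite psumr_eq0; last by move=> i _; exact: Tpos.
  by move=> /allP/(_ a (mem_index_enum a))/eqP.
rewrite -(@frame_sum (fun x' => T x' y y x) x (mlin4_1 TL y y x)).
by apply: big1 => a _; rewrite zero_plane_contract// mulr0.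
Qed.

Variables u v : V.
Hypothesis guu : g u u = 1.
Hypothesis gvv : g v v = 1.
Hypothesis guv : g u v = 0.
Hypothesis Tuv : T u v v u = 0.

Let N x y := T u x y u.
Let P x y := T v x y v.
Let D x y := T u x y v.

(** The second Bianchi identity in the slots of the second derivative and of the
first plane replaces the Laplacian by - H(a, u, v, a, v, u) - H(a, v, a, u, v, u).
Exchanging the two derivatives costs curvature terms C, by the Ricci identity,
and leaves the derivative of a divergence, which is zero.  It remains to expand
the terms C, using that T(u, v, v, .) and T(v, u, u, .) vanish: those from the T
part of R0 are quadratic in T, those from the constant curvature part are linear
and contract to traces. *)
Lemma laplacian_zero_plane : \sum_a H (e a) (e a) u v v u =
  - 2 * delta * tau + \sum_a \sum_b
    (4 * D (e a) (e b) * D (e b) (e a) - D (e a) (e b) ^+ 2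
     - D (e b) (e a) ^+ 2 - 2 * N (e a) (e b) * P (e a) (e b)).
Proof.
have z1 w : T u v v w = 0 by apply: zero_plane_contract.
have z2 w : T v u u w = 0 by apply: zero_plane_contract; rewrite Tpair.
pose C p q x y z w := \sum_m (R0 p q x (e m) * T (e m) y z w +
  R0 p q y (e m) * T x (e m) z w + R0 p q z (e m) * T x y (e m) w +
  R0 p q w (e m) * T x y z (e m)).
have Hpair p q := curv_pair real_addrr_eq0 (Hcurv p q).
have HC p q x y z w : H p q x y z w = H q p x y z w - C p q x y z w.
  by rewrite /C -Hricci addrC subrK.
(* By the second Bianchi identity, the divergence is a difference of derivatives
   of the trace, which is parallel. *)
have div0 p x y z : \sum_a H p (e a) x (e a) y z = 0.
  rewrite (eq_bigr (fun a => H p y (e a) z x (e a) - H p z (e a) y x (e a))).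
    by rewrite sumrB !Htrace subrr.
  move=> a _; have := Hbianchi p (e a) y z x (e a).
  by rewrite (Hpair p (e a) y z) (curv_skew12 (Hcurv p y) (e a)); lra.
have lapC : \sum_a H (e a) (e a) u v v u =
    \sum_a (C (e a) u v (e a) v u + C (e a) v (e a) u v u).
  have HE a : H (e a) (e a) u v v u =
      C (e a) u v (e a) v u + C (e a) v (e a) u v u
      - (H u (e a) v (e a) v u - H v (e a) u (e a) v u).
    have := Hbianchi (e a) (e a) u v v u; rewrite (HC (e a) u) (HC (e a) v).
    by rewrite (curv_skew12 (Hcurv v (e a)) u) => h; apply/subr0_eq; rewrite -[RHS]h; ring.
  by rewrite (eq_bigr _ (fun a _ => HE a)) sumrB sumrB !div0 subrr subr0.
(* The linear part of the curvature terms, before contraction over m: fu, fv and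
   fa collect what multiplies g(u, e_m), g(v, e_m) and g(e_a, e_m). *)
pose fu a x := - (g v (e a) * (T x (e a) v u + T v (e a) x u))
  - g u (e a) * T v (e a) v x.
pose fv a x := - (g u (e a) * (T (e a) x v u + T (e a) u v x))
  - g v (e a) * T (e a) u x u.
pose fa a x := T v (e a) v x + T (e a) u x u.
have fuL a : lin1 (fu a).
  move=> c x y; rewrite /fu (mlin4_1 TL) (mlin4_3 TL) (mlin4_4 TL); ring.
have fvL a : lin1 (fv a).
  move=> c x y; rewrite /fv (mlin4_2 TL) (mlin4_3 TL) (mlin4_4 TL); ring.
have faL a : lin1 (fa a).
  move=> c x y; rewrite /fa (mlin4_3 TL) (mlin4_4 TL); ring.
pose K a m := g u (e m) * fu a (e m) + g v (e m) * fv a (e m)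
  + g (e a) (e m) * fa a (e m).
(* The quadratic part of the curvature terms. *)
pose Q a m := 4 * D (e a) (e m) * D (e m) (e a) - D (e a) (e m) ^+ 2
     - D (e m) (e a) ^+ 2 - 2 * N (e a) (e m) * P (e a) (e m).
(* Every component of T with two slots in the plane of u and v, reduced to
   N, P, D or 0. *)
have zv x : T v x v u = 0 by rewrite -Tpair T12 z1 oppr0.
have zm x : T x u v u = 0 by rewrite -Tpair T34 z2 oppr0.
have Eau x y : T x u v y = D x y by rewrite T12 T34 opprK.
have Evu x y : T v x y u = D y x by rewrite Tpair T12 T34 opprK.
have Eav x y : T x y v u = D x y - D y x.
  have h := curv_bianchi Tcurv u x y v; rewrite (T12 u y) in h.
  by apply/subr0_eq; rewrite -[RHS]oppr0 -h (T34 x y u v) /D; ring.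
have Eu x y : T x u u y = N x y by rewrite T12 T34 opprK.
have Ev x y : T x v v y = P x y by rewrite T12 T34 opprK.
have Euu x y : T x u y u = - N x y by rewrite T12.
have Evv x y : T v x v y = - P x y by rewrite T34.
have Eva x y : T x v u y = D y x by rewrite T12 T34 opprK.
have QK a : C (e a) u v (e a) v u + C (e a) v (e a) u v u =
    \sum_m (Q a m + delta * K a m).
  rewrite -big_split /=; apply: eq_bigr => m _.
  rewrite /R0 /const_curv /Q /K /fu /fv /fa.
  rewrite !(zv, zm, Eav, Eau, Evu, Eu, Ev, Eva, Euu, Evv) guv guu gvv.
  rewrite (gC (e a) u) (gC (e a) v) (gC v u) guv.
  ring.
have sumK a : \sum_m K a m = T v (e a) v (e a) + T (e a) u (e a) u
   - (g v (e a) * (T u (e a) v u + T v (e a) u u) + g u (e a) * T v (e a) v u)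
   - (g u (e a) * (T (e a) v v u + T (e a) u v v) + g v (e a) * T (e a) u v u).
  by rewrite big_split big_split /= !frame_sum// /fu /fv /fa; ring.
rewrite lapC (eq_bigr _ (fun a _ => QK a)).
under eq_bigr do rewrite big_split /= -mulr_sumr sumK.
rewrite big_split /= addrC; congr (_ + _).
rewrite -mulr_sumr sumrB sumrB big_split /=.
have T1L y z w := mlin4_1 TL y z w.
have tr_v : \sum_a T v (e a) v (e a) = - tau.
  under eq_bigr => a _ do rewrite T12.
  by rewrite sumrN Ttrace gvv mulr1.
have tr_u : \sum_a T (e a) u (e a) u = - tau.
  under eq_bigr => a _ do rewrite T34.
  by rewrite sumrN Ttrace guu mulr1.
have T12d := curv_diag12 _ _ _ Tcurv; have T34d := curv_diag34 _ _ _ Tcurv.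
have -> : \sum_a (g v (e a) * (T u (e a) v u + T v (e a) u u) +
                  g u (e a) * T v (e a) v u) = 0.
  rewrite big_split /= (@frame_sum (fun x => T u x v u + T v x u u)); last first.
    by move=> c x y; rewrite !(mlin4_2 TL); ring.
  rewrite (@frame_sum (fun x => T v x v u)); last exact: mlin4_2.
  by rewrite T34d zv Tuv; ring.
have -> : \sum_a (g u (e a) * (T (e a) v v u + T (e a) u v v) +
                  g v (e a) * T (e a) u v u) = 0.
  rewrite big_split /= (@frame_sum (fun x => T x v v u + T x u v v)); last first.
    by move=> c x y; rewrite !(mlin4_1 TL); ring.
  rewrite (@frame_sum (fun x => T x u v u)); last exact: mlin4_1.
  by rewrite T34d zm Tuv; ring.
by rewrite tr_v tr_u; ring.
Qed.

(** T is nonnegative on the planes of u + v, t y + x and of - u + v, - t y + x.  The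
sum of the two values is 2 (N + P)(x, x) + 4 t (D(x, y) + D(y, x))
+ 2 t^2 (N + P)(y, y), the other terms being odd in (u, y); so the discriminant of
this polynomial in t is nonpositive. *)
Lemma mixed_bound x y : (D x y + D y x) ^+ 2 <=
  (N x x + P x x) * (N y y + P y y).
Proof.
have L_ge0 w : 0 <= N w w + P w w by rewrite addr_ge0 ?Tpos.
suff : (2 * (D x y + D y x)) ^+ 2 <= (2 * (N y y + P y y)) * (2 * (N x x + P x x)).
  nra.
apply: discriminant_le; first by rewrite mulr_ge0.
move=> t; have h1 := Tpos (1 *: u + v) (t *: y + x).
have h2 := Tpos (-1 *: u + v) (- t *: y + x).
have DE p q : T v p q u = D q p by rewrite /D Tpair T12 T34 opprK.
move: h1 h2; rewrite !(mlin4_1 TL) !(mlin4_4 TL) !(mlin4_2 TL) !(mlin4_3 TL).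
rewrite !DE -!/(N _ _) -!/(P _ _) -!/(D _ _).
lra.
Qed.

(** Summing [mixed_bound] over the frame bounds the quadratic terms of
[laplacian_zero_plane], and 0 <= - 2 delta tau + 2 tau^2 follows. *)
Lemma trace_eq0_of_pinching : (forall p, 0 <= H p p u v v u) -> tau < delta -> tau = 0.
Proof.
move=> Hpos tau_lt.
pose L a := N (e a) (e a) + P (e a) (e a).
have trN : \sum_a N (e a) (e a) = tau.
  rewrite -[tau]mulr1 -guu -Ttrace; apply: eq_bigr => a _.
  by rewrite /N Tpair.
have trP : \sum_a P (e a) (e a) = tau.
  rewrite -[tau]mulr1 -gvv -Ttrace; apply: eq_bigr => a _.
  by rewrite /P Tpair.
have tau_ge0 : 0 <= tau by rewrite -trN; apply: sumr_ge0 => a _; exact: Tpos.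
have := @sumr_ge0 R _ (index_enum 'I_n) xpredT _ (fun a _ => Hpos (e a)).
rewrite laplacian_zero_plane.
have NP_ge0 : 0 <= \sum_a \sum_b N (e a) (e b) * P (e a) (e b).
  apply: psd_frame_pair => //.
  - by split=> ?; [exact: mlin4_2 | exact: mlin4_3].
  - by split=> ?; [exact: mlin4_2 | exact: mlin4_3].
  - by move=> x y; rewrite /N Tpair T12 T34 opprK.
  - by move=> x; apply: Tpos.
  - by move=> x; apply: Tpos.
(* 4 x y - x^2 - y^2 = (x + y)^2 / 2 - 3 (x - y)^2 / 2, with x + y controlled by
   the traces of N + P. *)
have DS_le : \sum_a \sum_b (4 * D (e a) (e b) * D (e b) (e a)
     - D (e a) (e b) ^+ 2 - D (e b) (e a) ^+ 2) <= 2 * tau ^+ 2.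
  apply: (@le_trans _ _ (\sum_a \sum_b 2^-1 * (L a * L b))).
    apply: ler_sum => a _; apply: ler_sum => b _.
    have := mixed_bound (e a) (e b); rewrite -/(L a) -/(L b).
    have := sqr_ge0 (D (e a) (e b) - D (e b) (e a)).
    move: (D _ _) (D _ _) (L _ * L _) => x y z; nra.
  under eq_bigr do rewrite -mulr_sumr -mulr_sumr mulrCA.
  rewrite -mulr_suml /L big_split /= trN trP; lra.
under eq_bigr do rewrite sumrB; rewrite sumrB.
under [X in _ - X]eq_bigr do
  (under eq_bigr do rewrite -mulrA; rewrite -mulr_sumr).
rewrite -mulr_sumr => ge0.
have : tau * (delta - tau) <= 0 by nra.
by rewrite pmulr_lle0 ?subr_gt0// => tau_le0; apply: le_anti; rewrite tau_le0.
Qed.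

End Core.

End Frame.

(** * Tensor calculus of a metric connection over a commutative ring *)

Section Connection.
Variables (A : comNzRingType) (V : lmodType A).
Variables (act : V -> A -> A) (nab : V -> V -> V) (g : V -> V -> A).

Local Notation br X Y := (nab X Y - nab Y X).

(** The axioms of a torsion free metric connection on a module of fields V over a
ring of functions A.  Torsion freeness is built in: the bracket of X and Y is by
definition nab X Y - nab Y X, and it is required to act as the commutator of
derivations and to satisfy the Jacobi identity. *)
Record levi_civita : Prop := LeviCivita {
  actD : forall X f h, act X (f + h) = act X f + act X h;
  actM : forall X f h, act X (f * h) = act X f * h + f * act X h;
  actL : forall f, lin1 (act^~ f);
  nabL : forall Y a X X', nab (a *: X + X') Y = a *: nab X Y + nab X' Y;
  nabDr : forall X Y Z, nab X (Y + Z) = nab X Y + nab X Z;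
  nabZr : forall X a Y, nab X (a *: Y) = act X a *: Y + a *: nab X Y;
  act_br : forall X Y f, act (br X Y) f = act X (act Y f) - act Y (act X f);
  br_jacobi : forall X Y Z,
    br X (br Y Z) + br Y (br Z X) + br Z (br X Y) = 0;
  metric_bilin : bilin g;
  metricC : forall X Y, g X Y = g Y X;
  metric_compat : forall X Y Z,
    act X (g Y Z) = g (nab X Y) Z + g Y (nab X Z) }.

Hypothesis LC : levi_civita.

Lemma act0 X : act X 0 = 0.
Proof.
by apply: (@addrI _ (act X 0)); rewrite -(actD LC) !addr0.
Qed.

Lemma actN X f : act X (- f) = - act X f.
Proof. by apply/eqP; rewrite -addr_eq0 -(actD LC) addNr act0. Qed.

Lemma actB X f h : act X (f - h) = act X f - act X h.
Proof. by rewrite (actD LC) actN. Qed.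

Lemma nabDl X X' Y : nab (X + X') Y = nab X Y + nab X' Y.
Proof. by rewrite -[X in LHS]scale1r (nabL LC) scale1r. Qed.

Lemma nab0l Y : nab 0 Y = 0.
Proof. by apply: (@addrI _ (nab 0 Y)); rewrite -nabDl !addr0. Qed.

Lemma nabNl X Y : nab (- X) Y = - nab X Y.
Proof. by apply/eqP; rewrite -addr_eq0 -nabDl addNr nab0l. Qed.

Lemma nabZl a X Y : nab (a *: X) Y = a *: nab X Y.
Proof. by rewrite -[a *: X]addr0 (nabL LC) nab0l addr0. Qed.

Lemma nab0r Y : nab Y 0 = 0.
Proof. by apply: (@addrI _ (nab Y 0)); rewrite -(nabDr LC) !addr0. Qed.

Lemma nabNr X Y : nab X (- Y) = - nab X Y.
Proof. by apply/eqP; rewrite -addr_eq0 -(nabDr LC) addNr nab0r. Qed.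

Let gl Y := (metric_bilin LC).1 Y.
Let gr X := (metric_bilin LC).2 X.

Lemma metricDl X Y Z : g (X + Y) Z = g X Z + g Y Z.
Proof. exact: lin1D (gl Z) X Y. Qed.
Lemma metricNl X Z : g (- X) Z = - g X Z.
Proof. exact: lin1N (gl Z) X. Qed.
Lemma metricZl a X Z : g (a *: X) Z = a * g X Z.
Proof. exact: lin1Z (gl Z) a X. Qed.

Let addE := (nabDl, nabNl, nabDr LC, nabNr, metricDl, metricNl).

Definition curv_op X Y Z := nab X (nab Y Z) - nab Y (nab X Z) - nab (br X Y) Z.
Definition Rm X Y Z W := g (curv_op X Y Z) W.

Lemma RmE X Y Z W : Rm X Y Z W = g (nab X (nab Y Z)) W - g (nab Y (nab X Z)) W
  - g (nab (nab X Y) Z) W + g (nab (nab Y X) Z) W.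
Proof. by rewrite /Rm /curv_op !addE; ring. Qed.

Lemma Rm_mlin : mlin4 Rm.
Proof.
split.
- move=> Y Z W a X X'; rewrite !RmE !(nabZl, nabZr LC, addE, metricZl).
  by ring.
- move=> X Z W a Y Y'; rewrite !RmE !(nabZl, nabZr LC, addE, metricZl).
  by ring.
- move=> X Y W a Z Z'; rewrite !RmE !(nabZr LC, metricZl, addE).
  have := act_br LC X Y a; rewrite (lin1B (actL LC a)) => /eqP.
  rewrite -subr_eq0 => /eqP h.
  by apply/subr0_eq; rewrite -[RHS](mul0r (- g Z W)) -h; ring.
- by move=> X Y Z a W W'; rewrite /Rm gr.
Qed.

Lemma Rm_curv : (forall a : A, a + a = 0 -> a = 0) -> curv_sym Rm.
Proof.
move=> tor; split.
- by move=> X Y Z W; rewrite !RmE; ring.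
- have RZZ X Y Z : Rm X Y Z Z = 0.
    apply: tor; have := act_br LC X Y (g Z Z).
    rewrite !(metric_compat LC, actD LC) => /eqP; rewrite -subr_eq0 => /eqP h.
    rewrite -[RHS]oppr0 -h RmE (metricC LC Z (nab X (nab Y Z))).
    rewrite (metricC LC Z (nab Y (nab X Z))) (metricC LC Z (nab (br X Y) Z)).
    by rewrite !addE; ring.
  move=> X Y Z W; apply/eqP; rewrite -addr_eq0; apply/eqP.
  have := RZZ X Y (1 *: Z + W).
  by rewrite (mlin4_3 Rm_mlin) !(mlin4_4 Rm_mlin) !RZZ !mul1r add0r addr0 addrC.
- move=> X Y Z W; rewrite !RmE.
  have := congr1 (g^~ W) (br_jacobi LC X Y Z).
  rewrite (lin1_0 (gl W)) !addE => <-; ring.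
Qed.

Definition covd X (T : V -> V -> V -> V -> A) a b c d := act X (T a b c d)
  - T (nab X a) b c d - T a (nab X b) c d - T a b (nab X c) d - T a b c (nab X d).

(** In covd X Rm, expand the derivative of g(R(Y, Z) U, W) by metric
compatibility; the cyclic sum is then a commutator expression in nab which cancels
up to the covariant derivative along a Jacobi sum. *)
Lemma Rm_bianchi2 X Y Z U W :
  covd Z Rm X Y U W + covd X Rm Y Z U W + covd Y Rm Z X U W = 0.
Proof.
have covdRm P Q S : covd P Rm Q S U W =
    g (nab P (curv_op Q S U)) W - g (curv_op (nab P Q) S U) W
    - g (curv_op Q (nab P S) U) W - g (curv_op Q S (nab P U)) W.
  by rewrite /covd /Rm (metric_compat LC); ring.
have := congr1 (fun Q => g (nab Q U) W) (br_jacobi LC X Y Z).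
rewrite /= nab0l (lin1_0 (gl W)) !addE => jac.
rewrite !covdRm /curv_op !addE -[RHS]oppr0 -jac; ring.
Qed.

Lemma covd_mlin X T : mlin4 T -> mlin4 (covd X T).
Proof.
case=> t1 t2 t3 t4; split.
- move=> y z w a p q; rewrite /covd (nabDr LC) (nabZr LC) !(t1, lin1D (t1 _ _ _)).
  by rewrite (lin1Z (t1 _ _ _)) (actD LC) (actM LC); ring.
- move=> x z w a p q; rewrite /covd (nabDr LC) (nabZr LC) !(t2, lin1D (t2 _ _ _)).
  by rewrite (lin1Z (t2 _ _ _)) (actD LC) (actM LC); ring.
- move=> x y w a p q; rewrite /covd (nabDr LC) (nabZr LC) !(t3, lin1D (t3 _ _ _)).
  by rewrite (lin1Z (t3 _ _ _)) (actD LC) (actM LC); ring.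
- move=> x y z a p q; rewrite /covd (nabDr LC) (nabZr LC) !(t4, lin1D (t4 _ _ _)).
  by rewrite (lin1Z (t4 _ _ _)) (actD LC) (actM LC); ring.
Qed.

Lemma covd_curv X T : curv_sym T -> curv_sym (covd X T).
Proof.
case=> s12 s34 b; split.
- move=> x y z w; rewrite /covd (s12 x) actN (s12 (nab X x)) (s12 x (nab X y)).
  by rewrite !(s12 x y); ring.
- move=> x y z w; rewrite /covd (s34 x y z) actN !(s34 _ _ z w).
  by rewrite (s34 x y (nab X z)) (s34 x y z (nab X w)); ring.
- move=> x y z w; rewrite /covd.
  have := b (nab X x) y z w; have := b x (nab X y) z w.
  have := b x y (nab X z) w; have := b x y z (nab X w).
  move=> h1 h2 h3 h4; have := congr1 (act X) (b x y z w).
  rewrite act0 !(actD LC) => h5.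
  transitivity (0 - 0 - 0 - 0 - 0 : A); last by ring.
  by rewrite -{1}h5 -{1}h4 -{1}h3 -{1}h2 -h1; ring.
Qed.

Lemma covd_dir X a Y T x y z w : mlin4 T ->
  covd (a *: X + Y) T x y z w = a * covd X T x y z w + covd Y T x y z w.
Proof.
case=> t1 t2 t3 t4; rewrite /covd (actL LC) !(nabL LC).
by rewrite (t1 y z w) (t2 x z w) (t3 x y w) (t4 x y z); ring.
Qed.

(** The second covariant derivative; subtracting the derivative along nab X Y makes
it linear over functions in both directions. *)
Definition hess X Y T a b c d :=
  covd X (covd Y T) a b c d - covd (nab X Y) T a b c d.

Lemma hess_curv X Y T : curv_sym T -> curv_sym (hess X Y T).
Proof.
move=> TC; have [s12 s34 b] := covd_curv X (covd_curv Y TC).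
have [s12' s34' b'] := covd_curv (nab X Y) TC; rewrite /hess; split.
- by move=> x y z w; rewrite s12 s12'; ring.
- by move=> x y z w; rewrite s34 s34'; ring.
- move=> x y z w; rewrite -[RHS](subr0 0) -{1}(b x y z w) -(b' x y z w); ring.
Qed.

Lemma hess_mlin X Y T : mlin4 T -> mlin4 (hess X Y T).
Proof.
move=> TL; have [s1 s2 s3 s4] := covd_mlin X (covd_mlin Y TL).
have [t1 t2 t3 t4] := covd_mlin (nab X Y) TL; rewrite /hess; split.
- by move=> y z w a p q; rewrite s1 t1; ring.
- by move=> y z w a p q; rewrite s2 t2; ring.
- by move=> y z w a p q; rewrite s3 t3; ring.
- by move=> y z w a p q; rewrite s4 t4; ring.
Qed.

(** The bracket acts as a commutator on the function T(x, y, z, w), so only the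
commutators of nab on the four arguments survive. *)
Lemma hess_ricci X Y T x y z w : mlin4 T ->
  hess X Y T x y z w - hess Y X T x y z w =
  - (T (curv_op X Y x) y z w + T x (curv_op X Y y) z w +
     T x y (curv_op X Y z) w + T x y z (curv_op X Y w)).
Proof.
move=> TL; have [t1 t2 t3 t4] := TL.
have := act_br LC X Y (T x y z w).
have brE : br X Y = (-1) *: nab Y X + nab X Y by rewrite scaleN1r addrC.
have br_covd : covd (nab X Y) T x y z w - covd (nab Y X) T x y z w =
   covd (br X Y) T x y z w by rewrite brE covd_dir//; ring.
move=> h; transitivity (covd X (covd Y T) x y z w - covd Y (covd X T) x y z w
  - covd (br X Y) T x y z w); first by rewrite -br_covd /hess; ring.
rewrite /covd h /curv_op !actB.
rewrite !(lin1B (t1 _ _ _)) !(lin1B (t2 _ _ _)) !(lin1B (t3 _ _ _)) !(lin1B (t4 _ _ _)).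
ring.
Qed.

Lemma hess_bianchi2 T :
    mlin4 T -> (forall X Y Z U W,
      covd Z T X Y U W + covd X T Y Z U W + covd Y T Z X U W = 0) ->
  forall P X Y Z U W,
  hess P Z T X Y U W + hess P X T Y Z U W + hess P Y T Z X U W = 0.
Proof.
move=> TL b2 P X Y Z U W.
have covdE S a b c d : covd P S a b c d = act P (S a b c d)
  - S (nab P a) b c d - S a (nab P b) c d - S a b (nab P c) d
  - S a b c (nab P d) by [].
have b0 := congr1 (act P) (b2 X Y Z U W).
rewrite act0 (actD LC P (_ + _)) (actD LC P (covd _ _ _ _ _ _)) in b0.
have bX := b2 (nab P X) Y Z U W; have bY := b2 X (nab P Y) Z U W.
have bZ := b2 X Y (nab P Z) U W; have bU := b2 X Y Z (nab P U) W.
have bW := b2 X Y Z U (nab P W).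
rewrite /hess ![covd P (covd _ _) _ _ _ _]covdE.
transitivity (0 - 0 - 0 - 0 - 0 - 0 : A); last by ring.
rewrite -{1}b0 -{1}bX -{1}bY -{1}bZ -{1}bU -bW. ring.
Qed.

Lemma covd_const_curv X a b c d : covd X (const_curv g) a b c d = 0.
Proof.
by rewrite /covd /const_curv actB !(actM LC) !(metric_compat LC); ring.
Qed.

Lemma eq_covd X T S : (forall a b c d, T a b c d = S a b c d) ->
  forall a b c d, covd X T a b c d = covd X S a b c d.
Proof. by move=> TS a b c d; rewrite /covd !TS. Qed.

Lemma covdD_scale X k T S a b c d : act X k = 0 ->
  covd X (fun a b c d => T a b c d + k * S a b c d) a b c d =
  covd X T a b c d + k * covd X S a b c d.
Proof. by move=> Xk; rewrite /covd (actD LC) (actM LC) Xk; ring. Qed.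

(** The constant curvature tensor is a polynomial in the metric, hence parallel.  So
the second derivatives of the curvature defect can be computed on the curvature
tensor, which satisfies the second Bianchi identity. *)
Lemma hess_shift X Y k T a b c d : (forall Z, act Z k = 0) ->
  hess X Y (fun a b c d => T a b c d + k * const_curv g a b c d) a b c d =
  hess X Y T a b c d.
Proof.
move=> k0; have E Z a' b' c' d' :
    covd Z (fun a b c d => T a b c d + k * const_curv g a b c d) a' b' c' d' =
    covd Z T a' b' c' d'.
  by rewrite covdD_scale// covd_const_curv mulr0 addr0.
by rewrite /hess (eq_covd X (E Y)) E.
Qed.

Section Trace.
Variables (n : nat) (E : 'I_n -> V) (co : V -> 'I_n -> A) (Gi : 'M[A]_n).
Hypothesis coE : forall x, x = \sum_i co x i *: E i.
Let G : 'M[A]_n := \matrix_(i, j) g (E i) (E j).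
Hypothesis GiG : Gi *m G = 1%:M.
Hypothesis GGi : G *m Gi = 1%:M.

Definition gtrace (B : V -> V -> A) := \sum_i \sum_l Gi i l * B (E i) (E l).

Lemma map_act_mul X (M N : 'M[A]_n) : map_mx (act X) (M *m N) =
  map_mx (act X) M *m N + M *m map_mx (act X) N.
Proof.
apply/matrixP => i j; rewrite !mxE (big_morph _ (actD LC X) (act0 X)).
by rewrite -big_split; apply: eq_bigr => k _; rewrite (actM LC) !mxE.
Qed.

Lemma act1 X : act X 1 = 0.
Proof.
by apply: (@addrI _ (act X 1)); rewrite addr0 -[in RHS](mulr1 1) (actM LC) mulr1 mul1r.
Qed.

Lemma map_act_inverse_gram X : let om := \matrix_(i, m) co (nab X (E i)) m in
  map_mx (act X) Gi = - (Gi *m om + om^T *m Gi).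
Proof.
move=> om.
have actG : map_mx (act X) G = om *m G + G *m om^T.
  apply/matrixP => i l; rewrite !mxE (metric_compat LC); congr (_ + _).
    rewrite [in LHS](coE (nab X (E i))) (lin1_sum (gl _)).
    by apply: eq_bigr => m _; rewrite metricZl !mxE.
  rewrite [in LHS](coE (nab X (E l))) (lin1_sum (gr _)).
  by apply: eq_bigr => m _; rewrite (lin1Z (gr _)) !mxE mulrC.
have := map_act_mul X Gi G; rewrite GiG.
have -> : map_mx (act X) 1%:M = 0 :> 'M[A]_n.
  by apply/matrixP => i j; rewrite !mxE; case: eqP => _; rewrite ?act1 ?act0.
move=> /eqP; rewrite eq_sym addr_eq0 => /eqP h.
rewrite -[LHS]mulmx1 -GGi mulmxA h actG mulmxDr !mulmxA GiG mul1mx.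
by rewrite mulNmx mulmxDl -!mulmxA GGi mulmx1.
Qed.

(** The derivative of the inverse Gram matrix ([map_act_inverse_gram]) supplies
exactly the terms where nab falls on an argument, by cyclicity of the trace. *)
Lemma act_gtrace X B : bilin B -> act X (gtrace B) =
  gtrace (fun a b => act X (B a b) - B (nab X a) b - B a (nab X b)).
Proof.
move=> [B1 B2]; pose om := \matrix_(i, m) co (nab X (E i)) m.
pose b := \matrix_(i, l) B (E i) (E l).
have gtr (B' : V -> V -> A) : gtrace B' = \tr (Gi *m (\matrix_(i, l) B' (E i) (E l))^T).
  by rewrite /mxtrace; apply: eq_bigr => i _; rewrite mxE; apply: eq_bigr => l _; rewrite !mxE.
have omB : \matrix_(i, l) (B (nab X (E i)) (E l)) = om *m b.
  apply/matrixP => i l; rewrite !mxE [in LHS](coE (nab X (E i))) (lin1_sum (B1 _)).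
  by apply: eq_bigr => m _; rewrite (lin1Z (B1 _)) !mxE.
have Bom : \matrix_(i, l) (B (E i) (nab X (E l))) = b *m om^T.
  apply/matrixP => i l; rewrite !mxE [in LHS](coE (nab X (E l))) (lin1_sum (B2 _)).
  by apply: eq_bigr => m _; rewrite (lin1Z (B2 _)) !mxE mulrC.
have actb : \matrix_(i, l) act X (B (E i) (E l)) = map_mx (act X) b.
  by apply/matrixP => i l; rewrite !mxE.
have act_tr (M : 'M[A]_n) : act X (\tr M) = \tr (map_mx (act X) M).
  by rewrite /mxtrace (big_morph _ (actD LC X) (act0 X)); apply: eq_bigr => i _; rewrite mxE.
rewrite !gtr act_tr map_act_mul mxtraceD -/b.
have -> : \matrix_(i, l) (act X (B (E i) (E l)) - B (nab X (E i)) (E l) -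
    B (E i) (nab X (E l))) = map_mx (act X) b - om *m b - b *m om^T.
  by rewrite -omB -Bom; apply/matrixP => i l; rewrite !mxE.
have trB (M N : 'M[A]_n) : \tr (Gi *m (M - N)^T) = \tr (Gi *m M^T) - \tr (Gi *m N^T).
  by rewrite linearB /= mulmxBr linearB.
rewrite map_act_inverse_gram -/om !trB !trmx_mul trmxK map_trmx.
rewrite mulNmx mulmxDl linearN /= linearD /= [in RHS]mulmxA (mxtrace_mulC _ om^T).
by rewrite !mulmxA; ring.
Qed.

Definition ric (T : V -> V -> V -> V -> A) b c := gtrace (fun a d => T a b c d).

(** Traces commute with covariant derivatives ([act_gtrace]) and the metric is
parallel.  This is how the Einstein condition enters. *)
Lemma ric_covd T k : mlin4 T -> (forall X, act X k = 0) ->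
    (forall b c, ric T b c = k * g b c) ->
  forall X b c, ric (covd X T) b c = 0.
Proof.
move=> TL k0 ricT X b c.
have [t1 t2 t3 t4] := TL.
have := @act_gtrace X (fun a d => T a b c d) (conj (t1 b c) (fun a => t4 a b c)).
rewrite -/(ric T b c) ricT (actM LC) k0 (metric_compat LC) => h.
transitivity (k * (g (nab X b) c + g b (nab X c)) - ric T (nab X b) c - ric T b (nab X c)).
  rewrite -[k * _]add0r -(mul0r (g b c)) h /ric /gtrace -!sumrB.
  apply: eq_bigr => i _; rewrite -!sumrB; apply: eq_bigr => l _.
  by rewrite /covd; ring.
by rewrite !ricT; ring.
Qed.

Lemma ric_hess T k : mlin4 T -> (forall X, act X k = 0) ->
    (forall b c, ric T b c = k * g b c) ->
  forall X Y b c, ric (hess X Y T) b c = 0.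
Proof.
move=> TL k0 ricT X Y b c; have r1 := ric_covd TL k0 ricT.
have r2 : ric (covd X (covd Y T)) b c = 0.
  apply: (@ric_covd _ 0 (covd_mlin Y TL)) => [Z|b' c']; first exact: act0.
  by rewrite mul0r r1.
rewrite -[RHS](subr0 0) -{1}r2 -(r1 (nab X Y) b c) /ric /gtrace -sumrB.
apply: eq_bigr => i _; rewrite -sumrB; apply: eq_bigr => l _.
by rewrite /hess mulrBr.
Qed.

End Trace.

End Connection.

(** * The Levi-Civita connection in coordinates *)

Section Coordinates.
Variables (A : comNzRingType) (n : nat) (d : 'I_n -> A -> A).
Hypothesis dD : forall i f h, d i (f + h) = d i f + d i h.
Hypothesis dM : forall i f h, d i (f * h) = d i f * h + f * d i h.
Hypothesis dC : forall i j f, d i (d j f) = d j (d i f).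
Variables (G Gi : 'M[A]_n) (half : A).
Hypothesis symG : forall i j, G i j = G j i.
Hypothesis GiG : Gi *m G = 1%:M.
Hypothesis halfK : half + half = 1.

Local Notation V := 'rV[A]_n.

Definition fderiv (X : V) (f : A) := \sum_i X 0 i * d i f.
Definition chris k i j :=
  half * \sum_l Gi k l * (d i (G j l) + d j (G i l) - d l (G i j)).
Definition cov (X Y : V) : V :=
  \row_k (fderiv X (Y 0 k) + \sum_i \sum_j X 0 i * Y 0 j * chris k i j).
Definition gmetric (X Y : V) := \sum_i \sum_j X 0 i * Y 0 j * G i j.

Lemma derivation0 i : d i 0 = 0.
Proof. by apply: (@addrI _ (d i 0)); rewrite -dD !addr0. Qed.
Lemma derivation1 i : d i 1 = 0.
Proof. by apply: (@addrI _ (d i 1)); rewrite addr0 -[in RHS](mulr1 1) dM mulr1 mul1r. Qed.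
Lemma derivation_nat i (b : bool) : d i b%:R = 0.
Proof. by case: b; rewrite ?derivation1 ?derivation0. Qed.

Lemma fderivD X f h : fderiv X (f + h) = fderiv X f + fderiv X h.
Proof. by rewrite -big_split; apply: eq_bigr => i _; rewrite dD mulrDr. Qed.

Lemma fderivM X f h : fderiv X (f * h) = fderiv X f * h + f * fderiv X h.
Proof.
rewrite mulr_suml mulr_sumr -big_split; apply: eq_bigr => i _.
by rewrite /= dM; ring.
Qed.

Lemma fderivL f : lin1 (fderiv^~ f).
Proof.
move=> a X Y; rewrite mulr_sumr -big_split; apply: eq_bigr => i _.
by rewrite /= !mxE; ring.
Qed.

Lemma fderiv_sum X I (r : seq I) (F : I -> A) :
  fderiv X (\sum_(i <- r) F i) = \sum_(i <- r) fderiv X (F i).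
Proof.
apply: (big_morph _ (fderivD X)).
by apply: big1 => i _; rewrite derivation0 mulr0.
Qed.

Lemma chrisC k i j : chris k i j = chris k j i.
Proof.
congr (_ * _); apply: eq_bigr => l _; congr (_ * _).
by rewrite [d i _ + _]addrC (symG i j).
Qed.

Lemma covL Y a X X' : cov (a *: X + X') Y = a *: cov X Y + cov X' Y.
Proof.
apply/rowP => k; rewrite !mxE fderivL mulrDr addrACA; congr (_ + _).
rewrite mulr_sumr -big_split; apply: eq_bigr => i _.
rewrite /= mulr_sumr -big_split; apply: eq_bigr => j _.
by rewrite /= !mxE; ring.
Qed.

Lemma covDr X Y Z : cov X (Y + Z) = cov X Y + cov X Z.
Proof.
apply/rowP => k; rewrite !mxE fderivD addrACA; congr (_ + _).
rewrite -big_split; apply: eq_bigr => i _.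
rewrite -big_split; apply: eq_bigr => j _.
by rewrite /= !mxE; ring.
Qed.

Lemma covZr X a Y : cov X (a *: Y) = fderiv X a *: Y + a *: cov X Y.
Proof.
apply/rowP => k; rewrite !mxE fderivM mulrDr -addrA; congr (_ + (_ + _)).
rewrite mulr_sumr; apply: eq_bigr => i _.
rewrite mulr_sumr; apply: eq_bigr => j _.
by rewrite /= !mxE; ring.
Qed.

Lemma cov_brE X Y k :
  (cov X Y - cov Y X) 0 k = fderiv X (Y 0 k) - fderiv Y (X 0 k).
Proof.
rewrite !mxE [X in _ - (_ + X)]exchange_big /=.
rewrite [X in _ - (_ + X)](_ : _ = \sum_i \sum_j X 0 i * Y 0 j * chris k i j).
  by ring.
by apply: eq_bigr => i _; apply: eq_bigr => j _; rewrite chrisC; ring.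
Qed.

Lemma fderiv_br X Y f : fderiv (cov X Y - cov Y X) f =
  fderiv X (fderiv Y f) - fderiv Y (fderiv X f).
Proof.
rewrite !fderiv_sum.
have E U W : \sum_k fderiv U (W 0 k * d k f) =
  \sum_k fderiv U (W 0 k) * d k f + \sum_i \sum_k U 0 i * W 0 k * d i (d k f).
  rewrite [X in _ + X]exchange_big -big_split; apply: eq_bigr => k _ /=.
  rewrite fderivM; congr (_ + _); rewrite mulr_sumr; apply: eq_bigr => i _.
  by ring.
rewrite !E [X in _ - (_ + X)]exchange_big /=.
rewrite [X in _ - (_ + X)](_ : _ = \sum_i \sum_k X 0 i * Y 0 k * d i (d k f)).
  rewrite opprD addrACA subrr addr0 -sumrB; apply: eq_bigr => k _.
  by rewrite cov_brE; ring.
by apply: eq_bigr => i _; apply: eq_bigr => j _; rewrite dC; ring.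
Qed.

Lemma cov_jacobi X Y Z (br := fun X Y => cov X Y - cov Y X) :
  br X (br Y Z) + br Y (br Z X) + br Z (br X Y) = 0.
Proof.
have fB U f h : fderiv U (f - h) = fderiv U f - fderiv U h.
  by apply/eqP; rewrite -subr_eq0 opprB addrA -fderivD subrK subrr.
apply/rowP => k; rewrite 2!mxE [RHS]mxE /br !cov_brE !fB !fderiv_br; ring.
Qed.

Lemma gmetric_bilin : bilin gmetric.
Proof.
split=> [Y a X X'|X a Y Y'].
  rewrite mulr_sumr -big_split; apply: eq_bigr => i _.
  rewrite mulr_sumr -big_split; apply: eq_bigr => j _.
  by rewrite /= !mxE; ring.
rewrite mulr_sumr -big_split; apply: eq_bigr => i _.
rewrite mulr_sumr -big_split; apply: eq_bigr => j _.
by rewrite /= !mxE; ring.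
Qed.

Lemma gmetric_delta i j : gmetric (delta_mx 0 i) (delta_mx 0 j) = G i j.
Proof.
rewrite /gmetric (bigD1 i)//= [X in _ + X]big1 ?addr0 => [|i' i'i]; last first.
  by apply: big1 => j' _; rewrite mxE (negbTE i'i) andbF !mul0r.
rewrite (bigD1 j)//= [X in _ + X]big1 => [|j' j'j]; first by rewrite !mxE !eqxx !mul1r addr0.
by rewrite !mxE (negbTE j'j) andbF mulr0 mul0r.
Qed.

Lemma gmetricC X Y : gmetric X Y = gmetric Y X.
Proof.
rewrite /gmetric exchange_big; apply: eq_bigr => i _; apply: eq_bigr => j _.
by rewrite symG; ring.
Qed.

(** Lowering the index of a Christoffel symbol cancels the inverse metric, which is
what makes the connection compatible with the metric. *)
Lemma chris_lower a b j : \sum_k chris k a b * G k j =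
  half * (d a (G b j) + d b (G a j) - d j (G a b)).
Proof.
pose c : 'rV[A]_n := \row_l (d a (G b l) + d b (G a l) - d l (G a b)).
have GiC : Gi^T = Gi.
  have symG' : G^T = G by apply/matrixP => i k; rewrite mxE.
  have GGi : G *m Gi = 1%:M by exact: mulmx1C.
  by rewrite -[LHS]mulmx1 -GGi mulmxA -{1}symG' -trmx_mul GGi trmx1 mul1mx.
have : (half *: (c *m Gi *m G)) 0 j = half * (d a (G b j) + d b (G a j) - d j (G a b)).
  by rewrite -mulmxA GiG mulmx1 !mxE.
move=> <-; rewrite !mxE mulr_sumr; apply: eq_bigr => k _.
rewrite /chris !mxE mulrA; congr (_ * _ * _); apply: eq_bigr => l _.
by rewrite !mxE -[in RHS]GiC mxE mulrC.
Qed.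

Lemma gmetric_compat X Y Z :
  fderiv X (gmetric Y Z) = gmetric (cov X Y) Z + gmetric Y (cov X Z).
Proof.
(* L are the Christoffel symbols with lowered index and S3 is the trilinear form
   with these coefficients; the two copies of S3 in the sum of the right-hand side
   add up to the derivative of the coefficients of the metric. *)
pose L a b j := half * (d a (G b j) + d b (G a j) - d j (G a b)).
pose S3 (x y z : V) := \sum_a \sum_b \sum_j x 0 a * y 0 b * z 0 j * L a b j.
have swap3 (F : 'I_n -> 'I_n -> 'I_n -> A) :
    \sum_j \sum_a \sum_b F j a b = \sum_a \sum_b \sum_j F j a b.
  by rewrite exchange_big; apply: eq_bigr => a _; exact: exchange_big.
have gcov (P Q : V) : gmetric (cov X P) Q =
    \sum_i \sum_j fderiv X (P 0 i) * Q 0 j * G i j + S3 X P Q.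
  transitivity (\sum_i \sum_j fderiv X (P 0 i) * Q 0 j * G i j +
      \sum_i \sum_j \sum_a \sum_b X 0 a * P 0 b * Q 0 j * (chris i a b * G i j)).
    rewrite -big_split; apply: eq_bigr => i _; rewrite -big_split /=.
    apply: eq_bigr => j _; rewrite !mxE mulrDl mulrDl; congr (_ + _).
    rewrite -mulrA mulr_suml; apply: eq_bigr => a _; rewrite mulr_suml.
    by apply: eq_bigr => b _; ring.
  congr (_ + _); under eq_bigr => i _ do rewrite swap3.
  rewrite swap3; apply: eq_bigr => a _; apply: eq_bigr => b _.
  rewrite exchange_big; apply: eq_bigr => j _.
  by rewrite /L -chris_lower mulr_sumr.
rewrite (gmetricC Y (cov X Z)) !gcov fderiv_sum.
have -> : S3 X Z Y = \sum_a \sum_b \sum_j X 0 a * Y 0 b * Z 0 j * L a j b.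
  apply: eq_bigr => a _; rewrite exchange_big; apply: eq_bigr => b _.
  by apply: eq_bigr => j _; ring.
have -> : \sum_i \sum_j fderiv X (Z 0 i) * Y 0 j * G i j =
    \sum_i \sum_j Y 0 i * fderiv X (Z 0 j) * G i j.
  rewrite exchange_big; apply: eq_bigr => i _; apply: eq_bigr => j _.
  by rewrite symG; ring.
rewrite addrACA.
have -> : S3 X Y Z + \sum_a \sum_b \sum_j X 0 a * Y 0 b * Z 0 j * L a j b =
    \sum_i \sum_j \sum_a X 0 a * Y 0 i * Z 0 j * d a (G i j).
  under [RHS]eq_bigr => i _ do rewrite exchange_big.
  rewrite [RHS]exchange_big -big_split; apply: eq_bigr => a _ /=.
  rewrite -big_split; apply: eq_bigr => b _ /=.
  rewrite -big_split; apply: eq_bigr => j _ /=.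
  rewrite -mulrDr /L -mulrDr (symG j b); congr (_ * _).
  by rewrite -[RHS]mul1r -halfK; ring.
rewrite -!big_split; apply: eq_bigr => i _ /=; rewrite fderiv_sum -!big_split.
apply: eq_bigr => j _ /=; rewrite !fderivM.
have -> : \sum_a X 0 a * Y 0 i * Z 0 j * d a (G i j) = Y 0 i * Z 0 j * fderiv X (G i j).
  by rewrite /fderiv mulr_sumr; apply: eq_bigr => a _; ring.
by ring.
Qed.

(** Of the partial derivatives only additivity, the Leibniz rule and commutation
enter, so the classical computation holds over any ring with such derivations. *)
Lemma coordinates_levi_civita : levi_civita fderiv cov gmetric.
Proof.
split; [exact: fderivD|exact: fderivM|exact: fderivL|exact: covL|exact: covDr|
  exact: covZr|exact: fderiv_br|exact: cov_jacobi|exact: gmetric_bilin|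
  exact: gmetricC|exact: gmetric_compat].
Qed.

Lemma fderiv_delta i f : fderiv (delta_mx 0 i) f = d i f.
Proof.
rewrite /fderiv (bigD1 i)//= big1 ?addr0 => [|j ji]; rewrite mxE eqxx ?eqxx ?mul1r//.
by rewrite (negbTE ji) mul0r.
Qed.

Lemma cov_deltaE i (Y : V) k :
  cov (delta_mx 0 i) Y 0 k = d i (Y 0 k) + \sum_j Y 0 j * chris k i j.
Proof.
rewrite mxE fderiv_delta; congr (_ + _).
rewrite (bigD1 i)//= [X in _ + X]big1 ?addr0 => [|j ji].
  by apply: eq_bigr => j _; rewrite mxE !eqxx mul1r.
by apply: big1 => k' _; rewrite mxE (negbTE ji) andbF !mul0r.
Qed.

Lemma cov_delta i j k : cov (delta_mx 0 i) (delta_mx 0 j) 0 k = chris k i j.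
Proof.
rewrite cov_deltaE mxE eqxx derivation_nat add0r (bigD1 j)//= big1 => [|l lj].
  by rewrite mxE !eqxx mul1r addr0.
by rewrite mxE (negbTE lj) andbF mul0r.
Qed.

(** Coordinate fields commute, so the curvature of the connection is given by the
classical expression in Christoffel symbols. *)
Lemma curv_op_delta i j k l :
  curv_op cov (delta_mx 0 i) (delta_mx 0 j) (delta_mx 0 k) 0 l =
  d i (chris l j k) - d j (chris l i k)
   + \sum_m (chris l i m * chris m j k - chris l j m * chris m i k).
Proof.
rewrite /curv_op.
have -> : cov (delta_mx 0 i) (delta_mx 0 j) - cov (delta_mx 0 j) (delta_mx 0 i) = 0 :> V.
  by apply/rowP => k'; rewrite mxE [(- _ : 'M[A]_(_, _)) _ _]mxE !cov_delta chrisC subrr mxE.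
have -> : cov 0 (delta_mx 0 k) = 0 :> V.
  have := covL (delta_mx 0 k) (-1) 0 0; rewrite !scaler0 addr0 => ->.
  by rewrite scaleN1r addNr.
rewrite subr0 mxE [(- _ : 'M[A]_(_, _)) _ _]mxE (cov_deltaE i (cov _ _)).
rewrite (cov_deltaE j (cov _ _)) !cov_delta sumrB.
rewrite addrACA -opprD; congr (_ + _ - (_ + _)).
  by apply: eq_bigr => m _; rewrite cov_delta mulrC.
by apply: eq_bigr => m _; rewrite cov_delta mulrC.
Qed.

End Coordinates.

(** * Smooth functions on an open subset of the coordinate space *)

Section Line.
Context {R : realType} {V : normedModType R}.
Implicit Types (f : V -> R) (x v : V).

Lemma is_derive_line f x v (t l : R) : is_derive (t *: v + x) v f l ->
  is_derive t 1 (fun s : R => f (s *: v + x)) l.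
Proof.
move=> [fd fl].
have E : (fun h : R => h^-1 *: (((fun s : R => f (s *: v + x)) \o shift t)
     (h *: (1:R)) - f (t *: v + x))) =
   (fun h : R => h^-1 *: ((f \o shift (t *: v + x)) (h *: v) - f (t *: v + x))).
  apply/funext => h /=; congr (_ *: (f _ - _)).
  by rewrite /shift/= scalerDl addrA -[h%:A]/(h * 1) mulr1.
by split; rewrite /derivable /derive E.
Qed.

Lemma derivable_line_continuous f x v (t : R) : derivable f (t *: v + x) v ->
  {for t, continuous (fun s : R => f (s *: v + x))}.
Proof.
move=> /derivableP/is_derive_line[fd _].
exact/differentiable_continuous/derivable1_diffP.
Qed.

Lemma mean_value_line f x v (h : R) :
  (forall s, `|s| <= `|h| -> derivable f (s *: v + x) v) ->
  exists2 s, `|s| <= `|h| & f (h *: v + x) - f x = 'D_v f (s *: v + x) * h.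
Proof.
move=> fd.
have mvt (a b : R) : a <= b -> (forall s, a <= s <= b -> `|s| <= `|h|) ->
    exists2 s, `|s| <= `|h| &
      f (b *: v + x) - f (a *: v + x) = 'D_v f (s *: v + x) * (b - a).
  move=> ab abh.
  have [||s sab ->] := @MVT_segment R (fun s => f (s *: v + x))
      (fun s => 'D_v f (s *: v + x)) a b ab.
  - move=> s; rewrite in_itv /= => /andP[as_ sb].
    by apply/is_derive_line/derivableP/fd/abh; rewrite !ltW.
  - apply: continuous_in_subspaceT => s; rewrite inE /= in_itv /= => sh.
    exact/derivable_line_continuous/fd/abh.
  by exists s => //; apply: abh; move: sab; rewrite in_itv.
have [h0|h0] := leP 0 h.
  have [|s sh] := mvt 0 h h0.
    by move=> s /andP[s0 sh]; rewrite !ger0_norm.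
  by rewrite scale0r add0r subr0 => fE; exists s.
have [|s sh] := mvt h 0 (ltW h0).
  by move=> s /andP[hs s0]; rewrite !ler0_norm ?lerN2// ltW.
rewrite scale0r add0r sub0r mulrN => fE; exists s => //.
by rewrite -opprB fE opprK.
Qed.

Lemma is_derive_scale_dir f x v (c : R) : derivable f x v ->
  is_derive x (c *: v) f (c * 'D_v f x).
Proof.
move=> fv; pose F (s : R) := f (s *: v + x).
have [Fd FE] : is_derive (0 : R) 1 F ('D_v f x).
  by apply: is_derive_line; rewrite scale0r add0r; exact: derivableP.
have dF : differentiable F 0 by exact/derivable1_diffP.
have E : (fun h : R => h^-1 *: ((f \o shift x) (h *: (c *: v)) - f x)) =
  (fun h : R => h^-1 *: ((F \o shift 0) (h *: c) - F 0)).
  apply/funext => h /=; congr (_ *: (f _ - f _)); last by rewrite scale0r add0r.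
  by rewrite /shift/= addr0 scalerA.
have Dc : derivable F 0 c by exact: diff_derivable.
split; first by rewrite /derivable E.
rewrite {1}/derive E; transitivity ('D_c F 0) => //.
rewrite -FE (deriveE c dF) (deriveE (1 : R) dF) -[X in _ X = _]mulr1.
by rewrite -[c * 1]/(c *: 1) linearZ.
Qed.

(** Directional derivatives are additive in the direction as soon as one of them is
continuous: the increment along v + w is the increment along v followed by one
along w, and the mean value theorem evaluates the latter at a point near x. *)
Lemma is_derive_add_dir f x v w (U : set V) : open U -> U x ->
  (forall y, U y -> derivable f y w) -> {for x, continuous ('D_w f)} ->
  derivable f x v -> is_derive x (v + w) f ('D_v f x + 'D_w f x).
Proof.
move=> oU Ux fw cw fv.
suff lim_w : (fun h : R => h^-1 *: (f (h *: (v + w) + x) - f (h *: v + x))) @ 0^'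
    --> 'D_w f x.
  have lim_vw : (fun h : R => h^-1 *: ((f \o shift x) (h *: (v + w)) - f x)) @ 0^'
      --> 'D_v f x + 'D_w f x.
    rewrite [X in X @ _](_ : _ = (fun h : R => h^-1 *: ((f \o shift x) (h *: v) - f x))
       \+ (fun h : R => h^-1 *: (f (h *: (v + w) + x) - f (h *: v + x)))).
      exact: (cvgD (f := fun h : R => h^-1 *: ((f \o shift x) (h *: v) - f x)) fv lim_w).
    apply/funext => h /=; rewrite -scalerDr; congr (_ *: _).
    by rewrite [RHS]addrC addrA subrK.
  split; first by apply/cvg_ex; exists ('D_v f x + 'D_w f x).
  exact/cvg_lim.
apply/cvgrPdist_lt => e e0.
have /nbhs_ballP[r /= r0 rP] : \forall y \near x, U y /\ `|'D_w f x - 'D_w f y| < e.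
  near=> y; split; near: y; first exact: open_nbhs_nbhs.
  by move/cvgrPdist_lt : cw; apply.
pose m := `|v| + `|w| + 1.
have m0 : 0 < m by rewrite ltr_wpDl// addr_ge0.
near=> h.
have h0 : h != 0 by near: h; exact: nbhs_dnbhs_neq.
have hr : `|h| * m < r.
  rewrite -ltr_pdivlMr//; near: h; apply: dnbhs0_lt; exact: divr_gt0.
have inball s : `|s| <= `|h| -> ball x r (s *: w + (h *: v + x)).
  move=> sh; rewrite -ball_normE /= addrA opprD addrCA subrr addr0 normrN.
  apply: le_lt_trans hr; rewrite (le_trans (ler_normD _ _))// !normrZ /m.
  rewrite -addrA mulrDr mulrDr mulr1 addrC lerD2l.
  by rewrite -[leLHS]addr0 lerD// ler_wpM2r.
have [|s sh] := @mean_value_line f (h *: v + x) w h.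
  by move=> s sh; apply: fw; have [] := rP _ (inball s sh).
rewrite addrA -scalerDr (addrC w v) => ->.
rewrite /GRing.scale /= mulrC mulfK//.
by have [] := rP _ (inball s sh).
Unshelve. all: by end_near. Qed.

(** The mean value theorem, first along v for the difference of f and its translate
by t w, then along w. *)
Lemma second_difference f x v w (t : R) :
  (forall a b, `|a| <= `|t| -> `|b| <= `|t| ->
    derivable f (a *: v + (b *: w + x)) v /\
    derivable ('D_v f) (b *: w + (a *: v + x)) w) ->
  exists a b, [/\ `|a| <= `|t|, `|b| <= `|t| &
    f (t *: v + (t *: w + x)) - f (t *: v + x) - f (t *: w + x) + f x =
    'D_w ('D_v f) (b *: w + (a *: v + x)) * t * t].
Proof.
move=> fd.
pose F y := f (t *: w + y) - f y.
have dshift y : derivable f (t *: w + y) v -> is_derive y v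
    (fun z => f (t *: w + z)) ('D_v f (t *: w + y)).
  have E : (fun h : R => h^-1 *: (((fun z => f (t *: w + z)) \o shift y) (h *: v) -
      f (t *: w + y))) =
    (fun h : R => h^-1 *: ((f \o shift (t *: w + y)) (h *: v) - f (t *: w + y))).
    by apply/funext => h /=; rewrite /shift /= addrCA.
  by move=> fdy; split; rewrite /derivable /derive E.
have dF a : `|a| <= `|t| -> is_derive (a *: v + x) v F
    ('D_v f (t *: w + (a *: v + x)) - 'D_v f (a *: v + x)).
  move=> at_; apply: is_deriveB.
    have [fa _] := fd a t at_ (lexx `|t|).
    by apply: dshift; rewrite addrCA; exact: fa.
  apply: derivableP; have [] := fd a 0 at_; first by rewrite normr0.
  by rewrite scale0r add0r.
have [|a at_] := @mean_value_line F x v t.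
  by move=> a at_; have [] := dF a at_.
have [_ ->] := dF a at_ => FE.
have [|b bt E2] := @mean_value_line ('D_v f) (a *: v + x) w t.
  by move=> b bt; have [] := fd a b at_ bt.
exists a, b; split => //; rewrite -E2 -FE /F (addrCA (t *: v)); ring.
Qed.

Lemma half_dist_absurd (p q z : R) :
  `|q - z| < `|p - q| / 2 -> `|p - z| < `|p - q| / 2 -> False.
Proof.
move=> qz pz; suff : `|p - q| < `|p - q| by rewrite ltxx.
rewrite {1}(_ : p - q = (p - z) - (q - z)); last by ring.
by rewrite (le_lt_trans (ler_normB _ _))// [ltRHS]splitr ltrD.
Qed.

(** Symmetry of second derivatives: the second difference of f is symmetric in v and
w, and [second_difference] compares it with both mixed derivatives at points close
to x, where they are close to their values at x. *)
Lemma derive_comm f x v w (U : set V) : open U -> U x ->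
  (forall y, U y -> derivable f y v) -> (forall y, U y -> derivable f y w) ->
  (forall y, U y -> derivable ('D_v f) y w) ->
  (forall y, U y -> derivable ('D_w f) y v) ->
  {for x, continuous ('D_w ('D_v f))} -> {for x, continuous ('D_v ('D_w f))} ->
  'D_w ('D_v f) x = 'D_v ('D_w f) x.
Proof.
move=> oU Ux fv fw fvw fwv pc qc.
have dvw := @second_difference f x v w; have dwv := @second_difference f x w v.
set p := 'D_w ('D_v f) in pc dvw *; set q := 'D_v ('D_w f) in qc dwv *.
apply/eqP; rewrite -subr_eq0 -normr_eq0 -[_ == _]negbK; apply/negP => neq0.
set d := `|_ - _| in neq0.
have d0 : 0 < d by rewrite lt_neqAle eq_sym neq0 normr_ge0.
have d20 : 0 < d / 2 by exact: divr_gt0.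
have nU : \forall y \near x, U y := open_nbhs_nbhs (conj oU Ux).
have np : \forall y \near x, `|p x - p y| < d / 2.
  exact: (cvgrPdist_lt _ _).1 pc _ d20.
have nq : \forall y \near x, `|q x - q y| < d / 2.
  exact: (cvgrPdist_lt _ _).1 qc _ d20.
have [r /= r0 rP] := (nbhs_ballP x _).1 (filterI nU (filterI np nq)).
pose m := `|v| + `|w| + 1.
have m0 : 0 < m by rewrite ltr_wpDl// addr_ge0.
(* All the points a v + b w + x with |a|, |b| <= t lie in the ball of radius r. *)
pose t := r / (2 * m).
have t0 : 0 < t by rewrite divr_gt0// mulr_gt0.
have inball a b : `|a| <= `|t| -> `|b| <= `|t| -> ball x r (a *: v + (b *: w + x)).
  rewrite (gtr0_norm t0) => at_ bt.
  rewrite -ball_normE /= addrA opprD addrCA subrr addr0 normrN.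
  rewrite (le_lt_trans (ler_normD _ _))// !normrZ.
  apply: (@le_lt_trans _ _ (t * m)).
    by rewrite /m mulrDr mulrDr mulr1 -[leLHS]addr0 !lerD ?ler_wpM2r// ltW.
  rewrite /t invfM mulrA divfK ?gt_eqF//; lra.
have [|a [b [at_ bt Evw]]] := dvw t.
  move=> a b at_ bt; have [Uy _] := rP _ (inball a b at_ bt).
  by split; [exact: fv|rewrite addrCA; exact: fvw].
have [|b' [a' [bt' at' Ewv]]] := dwv t.
  move=> b' a' bt' at'; have [Uy _] := rP _ (inball a' b' at' bt').
  by split; [rewrite addrCA; exact: fw|exact: fwv].
have Eeq : p (b *: w + (a *: v + x)) = q (a' *: v + (b' *: w + x)).
  have tt0 : t != 0 by rewrite gt_eqF.
  apply: (mulIf tt0); apply: (mulIf tt0); apply: etrans (esym Evw) (etrans _ Ewv).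
  by rewrite (addrCA (t *: v)); congr (_ + _); exact: addrAC.
have [_ [+ _]] := rP _ (inball a b at_ bt); rewrite addrCA Eeq.
have [_ [_ +]] := rP _ (inball a' b' at' bt').
exact: half_dist_absurd.
Qed.

End Line.

Section SmoothOn.
Context {R : realType} {n : nat}.
Implicit Types (U : set 'rV[R]_n) (f g : 'rV[R]_n -> R).

Lemma eq_on_near U f g x : open U -> U x -> (forall y, U y -> f y = g y) ->
  \forall y \near x, f y = g y.
Proof.
by move=> oU Ux fg; apply: filterS fg (open_nbhs_nbhs (conj oU Ux)).
Qed.

Lemma eq_partial U f g i x : open U -> U x -> (forall y, U y -> f y = g y) ->
  partial f i x = partial g i x.
Proof. by move=> oU Ux fg; exact/near_eq_derive/(eq_on_near oU Ux fg). Qed.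

Lemma eq_on_continuous U f g x : open U -> U x -> (forall y, U y -> f y = g y) ->
  {for x, continuous f} -> {for x, continuous g}.
Proof.
move=> oU Ux fg fc; rewrite /prop_for /continuous_at -(fg x Ux).
exact: cvg_trans (near_eq_cvg (eq_on_near oU Ux fg)) fc.
Qed.

Lemma eq_Ck_on k U f g : open U -> (forall y, U y -> f y = g y) ->
  Ck_on k U f -> Ck_on k U g.
Proof.
move=> oU; elim: k f g => [|k IH] f g fg /= [fc fd]; split => //.
- by move=> x Ux; exact: eq_on_continuous oU Ux fg (fc x Ux).
- by move=> x Ux; exact: eq_on_continuous oU Ux fg (fc x Ux).
- move=> i; have [fdi fCi] := fd i; split.
    move=> x Ux; apply: near_eq_derivable (fdi x Ux).
    exact: eq_on_near oU Ux fg.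
  by apply: IH fCi => y Uy; exact: eq_partial oU Uy fg.
Qed.

Lemma Ck_onW k U f : Ck_on k.+1 U f -> Ck_on k U f.
Proof.
elim: k f => [|k IH] f; first by case.
by move=> [fc fd]; split=> // i; have [fdi /IH] := fd i.
Qed.

Lemma Ck_on_cst k U (c : R) : open U -> Ck_on k U (fun=> c).
Proof.
move=> oU; elim: k c => [|k IH] c; split => //; try by move=> x _; exact: cst_continuous.
move=> i; split; first by move=> x _; exact: derivable_cst.
by apply: eq_Ck_on oU _ (IH 0) => y _; rewrite /partial derive_cst.
Qed.

Lemma Ck_onD k U f g : open U -> Ck_on k U f -> Ck_on k U g ->
  Ck_on k U (f + g).
Proof.
move=> oU; elim: k f g => [|k IH] f g [fc fd] [gc gd];
  (split; first by move=> x Ux; exact: (continuousD (fc x Ux) (gc x Ux))) => //.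
move=> i; have [fdi fCi] := fd i; have [gdi gCi] := gd i; split.
  by move=> x Ux; apply: derivableD; [exact: fdi|exact: gdi].
apply: eq_Ck_on oU _ (IH _ _ fCi gCi) => x Ux.
by rewrite /partial deriveD//; [exact: fdi|exact: gdi].
Qed.

Lemma Ck_onM k U f g : open U -> Ck_on k U f -> Ck_on k U g ->
  Ck_on k U (f * g).
Proof.
move=> oU; elim: k f g => [|k IH] f g fC gC; have [fc fd] := fC;
  have [gc gd] := gC;
  (split; first by move=> x Ux; exact: (continuousM (fc x Ux) (gc x Ux))) => //.
move=> i; have [fdi fCi] := fd i; have [gdi gCi] := gd i; split.
  by move=> x Ux; apply: derivableM; [exact: fdi|exact: gdi].
apply: eq_Ck_on oU _ (Ck_onD oU (IH _ _ (Ck_onW fC) gCi)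
                                (IH _ _ (Ck_onW gC) fCi)) => x Ux.
by rewrite /partial deriveM//; [exact: fdi|exact: gdi].
Qed.

(** The derivative of 1/f is - f' / f^2, so the induction needs only products and
the induction hypothesis itself. *)
Lemma Ck_onV k U f : open U -> (forall x, U x -> f x != 0) ->
  Ck_on k U f -> Ck_on k U (fun x => (f x)^-1).
Proof.
move=> oU f0; elim: k => [|k IH] fC; have [fc fd] := fC;
  (split; first by move=> x Ux; exact: (continuousV (f0 x Ux) (fc x Ux))) => //.
move=> i; have [fdi fCi] := fd i; split.
  by move=> x Ux; apply: derivableV; [exact: f0|exact: fdi].
have fV := IH (Ck_onW fC).
apply: eq_Ck_on oU _ (Ck_onM oU (Ck_on_cst k (-1) oU)
   (Ck_onM oU (Ck_onM oU fV fV) fCi)) => x Ux.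
rewrite /partial deriveV//; [|exact: f0|exact: fdi].
by rewrite /= -[LHS]/(-1 * ((f x)^-1 * (f x)^-1 * _)) /GRing.scale /= expr2 invfM; ring.
Qed.

Lemma is_derive_coord (i : 'I_n) (x v : 'rV[R]_n) :
  is_derive x v (fun x : 'rV[R]_n => x 0 i) (v 0 i).
Proof.
have idx := @derivable_id _ _ x v.
split; first exact: ((derivable_mxP id x v).1 idx).
have := derive_mx idx; rewrite derive_id => /matrixP/(_ 0 i).
by rewrite mxE => <-.
Qed.

Lemma Ck_on_coord k U (i : 'I_n) : open U -> Ck_on k U (fun x => x 0 i).
Proof.
move=> oU; case: k => [|k]; split => //; try by move=> x Ux; exact: coord_continuous.
move=> j; split; first by move=> x Ux; have [] := is_derive_coord i x (delta_mx 0 j).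
apply: eq_Ck_on oU _ (Ck_on_cst k ((delta_mx 0 j : 'rV[R]_n) 0 i) oU) => x Ux.
by have [_] := is_derive_coord i x (delta_mx 0 j).
Qed.

(** The coordinate directions occurring in w are added one at a time, with
[is_derive_add_dir]. *)
Lemma is_derive_Ck_on U f x (w : 'rV[R]_n) : open U -> U x -> Ck_on 1 U f ->
  is_derive x w f (\sum_i w 0 i * partial f i x).
Proof.
move=> oU Ux [fc fd].
suff H (s : seq 'I_n) : is_derive x (\sum_(i <- s) w 0 i *: delta_mx 0 i) f
    (\sum_(i <- s) w 0 i * partial f i x).
  by rewrite {1}[w]row_sum_delta; exact: H.
elim: s => [|i s IH]; first by rewrite !big_nil; exact: is_derive0.
rewrite !big_cons.
move: (\sum_(j <- s) _ *: _) (\sum_(j <- s) _) IH => ds vs [fs <-].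
pose vi := w 0 i *: (delta_mx 0 i : 'rV[R]_n).
have [fdi [fic _]] := fd i.
have dz y : U y -> is_derive y vi f (w 0 i * partial f i y).
  by move=> Uy; exact: (is_derive_scale_dir _ (fdi y Uy)).
have vic : {for x, continuous ('D_vi f)}.
  apply: (@eq_on_continuous U (cst (w 0 i) * partial f i)) => //.
    by move=> y /dz[_ ->].
  by apply: continuousM; [exact: cst_continuous|exact: fic].
have fvi y : U y -> derivable f y vi by move=> /dz[].
have [_ dE] := dz x Ux.
have -> : w 0 i *: delta_mx 0 i + vs = vs + vi by exact: addrC.
have -> : w 0 i * partial f i x + 'D_vs f x = 'D_vs f x + 'D_vi f x.
  by rewrite dE; exact: addrC.
exact: is_derive_add_dir oU Ux fvi vic fs.
Qed.

Lemma partialC U f x i j : open U -> U x -> Ck_on 2 U f ->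
  partial (partial f i) j x = partial (partial f j) i x.
Proof.
move=> oU Ux [fc fd].
have [fdi [fic /(_ j)[fdij [fijc _]]]] := fd i.
have [fdj [fjc /(_ i)[fdji [fjic _]]]] := fd j.
exact: derive_comm oU Ux fdi fdj fdij fdji (fijc x Ux) (fjic x Ux).
Qed.

End SmoothOn.

(** * The ring of smooth functions on an open set *)

(** The base point serves to extend functions outside the open set, so that the
functions in [smooth_fun] are determined by their values on it. *)
Record pointed_open (R : realType) (n : nat) := PointedOpen {
  po_set :> set 'rV[R]_n;
  po_open : open po_set;
  po_pt : 'rV[R]_n;
  po_in : po_set po_pt }.

Arguments po_open {R n} p.
Arguments po_in {R n} p.

Section SmoothRing.
Context {R : realType} {n : nat} (D : pointed_open R n).
Implicit Types (f g : 'rV[R]_n -> R).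

Definition retract (x : 'rV[R]_n) : 'rV[R]_n :=
  if `[< po_set D x >] then x else po_pt D.

Lemma retract_in x : po_set D (retract x).
Proof. by rewrite /retract; case: asboolP => // _; exact: po_in. Qed.

Lemma retract_id x : po_set D x -> retract x = x.
Proof. by rewrite /retract => /asboolP ->. Qed.

(** Smooth functions on D are represented by total functions which take off D their
value at the base point.  Then equality of functions is equality on D, constants
are constant, and these functions form a subring of all functions. *)
Definition smooth_pred f := `[< smooth_on D f /\ f = f \o retract >].

Lemma smooth_onD f g : smooth_on D f -> smooth_on D g -> smooth_on D (f + g).
Proof. by move=> sf sg k; exact: Ck_onD (po_open D) (sf k) (sg k). Qed.

Lemma smooth_onM f g : smooth_on D f -> smooth_on D g -> smooth_on D (f * g).
Proof. by move=> sf sg k; exact: Ck_onM (po_open D) (sf k) (sg k). Qed.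

Lemma smooth_on_cst c : smooth_on D (fun=> c).
Proof. by move=> k; exact: Ck_on_cst (po_open D). Qed.

Lemma smooth_pred_subring : subring_closed smooth_pred.
Proof.
split.
- apply/asboolP; split; first exact: (smooth_on_cst 1).
  by apply/funext.
- move=> f g /asboolP[sf fE] /asboolP[sg gE]; apply/asboolP; split.
    have -> : f - g = f + (fun=> -1) * g.
      by apply/funext => x /=; rewrite -[LHS]/(f x - g x) -[RHS]/(f x + -1 * g x) mulN1r.
    exact: smooth_onD sf (smooth_onM (smooth_on_cst (-1)) sg).
  by apply/funext => x; rewrite -[LHS]/(f x - g x) {1}fE {1}gE.
- move=> f g /asboolP[sf fE] /asboolP[sg gE]; apply/asboolP; split.
    exact: smooth_onM.
  by apply/funext => x; rewrite -[LHS]/(f x * g x) {1}fE {1}gE.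
Qed.

HB.instance Definition _ := GRing.isSubringClosed.Build _ smooth_pred smooth_pred_subring.

Record smooth_fun := SmoothFun {
  smooth_val :> 'rV[R]_n -> R;
  smooth_valP : smooth_val \in smooth_pred }.

HB.instance Definition _ := [isSub for smooth_val].
HB.instance Definition _ := [Choice of smooth_fun by <:].
HB.instance Definition _ := [SubChoice_isSubComNzRing of smooth_fun by <:].

Lemma smooth_funP (f g : smooth_fun) :
  (forall x, po_set D x -> f x = g x) -> f = g.
Proof.
move=> fg; apply/val_inj/funext => x.
have [_ /(congr1 (@^~ x)) /= ->] := asboolP _ (smooth_valP f).
have [_ /(congr1 (@^~ x)) /= ->] := asboolP _ (smooth_valP g).
exact/fg/retract_in.
Qed.

Lemma smooth_fun_on (f : smooth_fun) : smooth_on D f.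
Proof. by have /asboolP[] := smooth_valP f. Qed.

Lemma smooth_fun_of_subproof f : smooth_on D f -> f \o retract \in smooth_pred.
Proof.
move=> sf; apply/asboolP; split.
  move=> k; apply: eq_Ck_on (po_open D) _ (sf k) => x Dx.
  by rewrite /= retract_id.
by apply/funext => x /=; rewrite (retract_id (retract_in x)).
Qed.

Definition smooth_fun_of f (sf : smooth_on D f) : smooth_fun :=
  SmoothFun (smooth_fun_of_subproof sf).

Lemma smooth_fun_ofE f (sf : smooth_on D f) x : po_set D x ->
  smooth_fun_of sf x = f x.
Proof. by move=> Dx; rewrite /= retract_id. Qed.

Definition cst_smooth (c : R) : smooth_fun := smooth_fun_of (smooth_on_cst c).

Lemma cst_smoothE c x : cst_smooth c x = c. Proof. by []. Qed.

Lemma smooth_on_coord i : smooth_on D (fun x => x 0 i).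
Proof. by move=> k; exact: Ck_on_coord (po_open D). Qed.

Lemma smooth_on_partial (f : smooth_fun) i : smooth_on D (partial f i).
Proof. by move=> k; have [_ /(_ i)[]] := smooth_fun_on f k.+1. Qed.

Definition dpart i (f : smooth_fun) : smooth_fun :=
  smooth_fun_of (smooth_on_partial f i).

Lemma dpartE i (f : smooth_fun) x : po_set D x -> dpart i f x = partial f i x.
Proof. exact: smooth_fun_ofE. Qed.

Definition ev x (f : smooth_fun) : R := f x.

Lemma ev_zmod x : zmod_morphism (ev x).
Proof. by []. Qed.
HB.instance Definition _ x := GRing.isZmodMorphism.Build smooth_fun R (ev x) (ev_zmod x).

Lemma ev_monoid x : monoid_morphism (ev x).
Proof. by []. Qed.
HB.instance Definition _ x := GRing.isMonoidMorphism.Build smooth_fun R (ev x) (ev_monoid x).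

Lemma evD x (f g : smooth_fun) : ev x (f + g) = ev x f + ev x g. Proof. by []. Qed.
Lemma evN x (f : smooth_fun) : ev x (- f) = - ev x f. Proof. by []. Qed.
Lemma evB x (f g : smooth_fun) : ev x (f - g) = ev x f - ev x g. Proof. by []. Qed.
Lemma evM x (f g : smooth_fun) : ev x (f * g) = ev x f * ev x g. Proof. by []. Qed.
Lemma ev_sum x I (r : seq I) (F : I -> smooth_fun) :
  ev x (\sum_(i <- r) F i) = \sum_(i <- r) ev x (F i).
Proof. exact: rmorph_sum. Qed.

Lemma ev_cst_smooth x c : ev x (cst_smooth c) = c. Proof. by []. Qed.

Lemma smooth_derivable (f : smooth_fun) (i : 'I_n) x : po_set D x ->
  derivable f x (delta_mx 0 i).
Proof. by have [_ /(_ i)[fd _]] := smooth_fun_on f 1; exact: fd. Qed.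

Lemma dpartD i (f g : smooth_fun) : dpart i (f + g) = dpart i f + dpart i g.
Proof.
apply: smooth_funP => x Dx; rewrite -[RHS]/(dpart i f x + dpart i g x).
rewrite !(dpartE _ _ Dx) -[smooth_val (f + g)]/(smooth_val f + smooth_val g).
exact: deriveD (smooth_derivable Dx) (smooth_derivable Dx).
Qed.

Lemma dpartM i (f g : smooth_fun) : dpart i (f * g) = dpart i f * g + f * dpart i g.
Proof.
apply: smooth_funP => x Dx.
rewrite -[RHS]/(dpart i f x * g x + f x * dpart i g x) !(dpartE _ _ Dx).
rewrite [RHS]addrC [X in _ + X]mulrC.
rewrite -[smooth_val (f * g)]/(smooth_val f * smooth_val g).
exact: deriveM (smooth_derivable Dx) (smooth_derivable Dx).
Qed.

Lemma dpartC i j (f : smooth_fun) : dpart i (dpart j f) = dpart j (dpart i f).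
Proof.
have dE k l x : po_set D x ->
    smooth_val (dpart k (dpart l f)) x = partial (partial f l) k x.
  move=> Dx; rewrite (dpartE k (dpart l f) Dx).
  by apply: (eq_partial k (po_open D) Dx) => y; exact: (dpartE l f).
apply: smooth_funP => x Dx; rewrite (dE i j x Dx) (dE j i x Dx).
exact: (partialC j i (po_open D) Dx (smooth_fun_on f 2)).
Qed.

Lemma dpart_cst_smooth i c : dpart i (cst_smooth c) = 0.
Proof.
apply: smooth_funP => x Dx; rewrite (dpartE i _ Dx).
by rewrite (_ : smooth_val (cst_smooth c) = cst c)//; exact: derive_cst.
Qed.

Definition coordf i : smooth_fun := smooth_fun_of (smooth_on_coord i).

Lemma dpart_coordf i j : dpart i (coordf j) = (i == j)%:R.
Proof.
transitivity (cst_smooth (i == j)%:R); last first.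
  by apply: smooth_funP => x Dx; rewrite cst_smoothE; case: (i == j).
apply: smooth_funP => x Dx; rewrite (dpartE i _ Dx) cst_smoothE.
rewrite (eq_partial i (po_open D) Dx (g := fun x : 'rV[R]_n => x 0 j)); last first.
  by move=> y; exact: (smooth_fun_ofE (smooth_on_coord j)).
have [_ dE] := is_derive_coord j x (delta_mx 0 i).
by rewrite /partial dE mxE eqxx eq_sym.
Qed.

Lemma smooth_onV (f : smooth_fun) : (forall x, po_set D x -> f x != 0) ->
  smooth_on D (fun x => (f x)^-1).
Proof. by move=> f0 k; exact: Ck_onV (po_open D) f0 (smooth_fun_on f k). Qed.

Lemma smooth_inv (f : smooth_fun) : (forall x, po_set D x -> f x != 0) ->
  exists g : smooth_fun, f * g = 1.
Proof.
move=> f0; exists (smooth_fun_of (smooth_onV f0)); apply: smooth_funP => x Dx.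
by rewrite -[LHS]/(f x * smooth_fun_of (smooth_onV f0) x) smooth_fun_ofE// divff ?f0.
Qed.

End SmoothRing.

(** * Evaluation at a point, and the curvature of a metric in a chart *)

Section Evaluation.
Context {R : realType} {n : nat} (D : pointed_open R n).
Local Notation A := (smooth_fun D).

Definition evV x (X : 'rV[A]_n) : 'rV[R]_n := map_mx (ev x) X.
Definition cstV (u : 'rV[R]_n) : 'rV[A]_n := map_mx (cst_smooth D) u.

Lemma cst_smoothD a b : cst_smooth D (a + b) = cst_smooth D a + cst_smooth D b.
Proof. exact: smooth_funP. Qed.
Lemma cst_smoothM a b : cst_smooth D (a * b) = cst_smooth D a * cst_smooth D b.
Proof. exact: smooth_funP. Qed.

Lemma evV_cstV x u : evV x (cstV u) = u.
Proof. by apply/rowP => i; rewrite !mxE. Qed.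

Lemma cstV_lin a u v : cstV (a *: u + v) = cst_smooth D a *: cstV u + cstV v.
Proof. by apply/rowP => i; rewrite !mxE cst_smoothD cst_smoothM. Qed.

Lemma cstV_delta i : cstV (delta_mx 0 i) = delta_mx 0 i.
Proof.
by apply/rowP => j; rewrite !mxE; apply: smooth_funP => x Dx; case: (_ && _).
Qed.

(** An expression linear over functions depends at x only on the value of its
argument at x: this is what makes it a tensor. *)
Lemma ev_lin1 x (f : 'rV[A]_n -> A) X : lin1 f ->
  ev x (f X) = \sum_i evV x X 0 i * ev x (f (delta_mx 0 i)).
Proof.
move=> fL; rewrite [in LHS](row_sum_delta X) (lin1_sum fL) ev_sum.
by apply: eq_bigr => i _; rewrite (lin1Z fL) evM mxE.
Qed.

Lemma ev_lin1_cst x (f : 'rV[A]_n -> A) X : lin1 f ->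
  ev x (f X) = ev x (f (cstV (evV x X))).
Proof. by move=> fL; rewrite !(ev_lin1 _ _ fL) evV_cstV. Qed.

(** The value at x of a tensor field; that it may be computed on constant fields is
[ev_tensor]. *)
Definition tensor_at x (T : 'rV[A]_n -> 'rV[A]_n -> 'rV[A]_n -> 'rV[A]_n -> A)
  (a b c d : 'rV[R]_n) : R := ev x (T (cstV a) (cstV b) (cstV c) (cstV d)).

Lemma ev_tensor x T X Y Z W : mlin4 T ->
  ev x (T X Y Z W) = tensor_at x T (evV x X) (evV x Y) (evV x Z) (evV x W).
Proof.
move=> [t1 t2 t3 t4]; rewrite /tensor_at (ev_lin1_cst _ _ (t1 _ _ _)).
by rewrite (ev_lin1_cst _ _ (t2 _ _ _)) (ev_lin1_cst _ _ (t3 _ _ _)) (ev_lin1_cst _ _ (t4 _ _ _)).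
Qed.

Lemma tensor_at_mlin x T : mlin4 T -> mlin4 (tensor_at x T).
Proof.
move=> [t1 t2 t3 t4]; split=> p q r a u v; rewrite /tensor_at cstV_lin.
- by rewrite (t1 _ _ _) evD evM.
- by rewrite (t2 _ _ _) evD evM.
- by rewrite (t3 _ _ _) evD evM.
- by rewrite (t4 _ _ _) evD evM.
Qed.

Lemma tensor_at_curv x T : curv_sym T -> curv_sym (tensor_at x T).
Proof.
move=> [s12 s34 b]; split=> *; rewrite /tensor_at.
- by rewrite s12 evN.
- by rewrite s34 evN.
- by rewrite -!evD b (rmorph0 (ev x)).
Qed.

End Evaluation.

Section LocalMetric.
Context {R : realType} {n : nat} (D : pointed_open R n).
Variable G : 'rV[R]_n -> 'M[R]_n.
Hypothesis smoothG : forall a b, smooth_on D (fun x => G x a b).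
Hypothesis symG : forall x, po_set D x -> (G x)^T = G x.
Hypothesis posG : forall x (u : 'rV[R]_n), po_set D x -> u != 0 ->
  0 < (u *m G x *m u^T) 0 0.
Local Notation A := (smooth_fun D).

Definition metric_mx : 'M[A]_n := \matrix_(i, j) smooth_fun_of (smoothG i j).

Lemma ev_metric_mx x : po_set D x -> map_mx (ev x) metric_mx = G x.
Proof.
by move=> Dx; apply/matrixP => i j; rewrite !mxE; exact: smooth_fun_ofE.
Qed.

Lemma metric_mx_sym i j : metric_mx i j = metric_mx j i.
Proof.
apply: smooth_funP => x Dx; have /matrixP/(_ i j) := symG Dx.
by rewrite -(ev_metric_mx Dx) !mxE.
Qed.

(** The determinant of the metric does not vanish, so it is invertible in the ring of
smooth functions, and Cramer's formula gives the inverse. *)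
Lemma metric_mx_inv : exists Gi : 'M[A]_n, Gi *m metric_mx = 1%:M.
Proof.
have [x Dx|dinv dinvE] := @smooth_inv _ _ D (\det metric_mx).
  rewrite -[X in X != _]/(ev x _) -det_map_mx ev_metric_mx// -unitfE -unitmxE.
  by apply: unit_posdef => u; exact: posG.
exists (dinv *: \adj metric_mx).
by rewrite -scalemxAl mul_adj_mx -mul_scalar_mx -scalar_mxM mulrC dinvE.
Qed.

Variable Gi : 'M[A]_n.
Hypothesis GiG : Gi *m metric_mx = 1%:M.

Lemma ev_Gi x : po_set D x -> map_mx (ev x) Gi = invmx (G x).
Proof.
move=> Dx; have : map_mx (ev x) Gi *m G x = 1%:M.
  by rewrite -(ev_metric_mx Dx) -map_mxM GiG map_mx1.
move=> E; have [_ Gu] := mulmx1_unit E.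
by rewrite -[LHS]mulmx1 -(mulmxV Gu) mulmxA E mul1mx.
Qed.

Definition one_half : A := cst_smooth D 2^-1.
Lemma one_halfK : one_half + one_half = 1.
Proof.
apply: smooth_funP => x Dx; rewrite -[LHS]/(2^-1 + 2^-1 : R) -[RHS]/(1 : R).
by lra.
Qed.

Local Notation dp := (@dpart R n D).
Local Notation act := (fderiv dp).
Local Notation Gam := (chris dp metric_mx Gi one_half).
Local Notation nab := (cov dp metric_mx Gi one_half).
Local Notation gm := (gmetric metric_mx).

Lemma local_levi_civita : levi_civita act nab gm.
Proof.
apply: coordinates_levi_civita; [exact: dpartD|exact: dpartM|exact: dpartC|
 exact: metric_mx_sym|exact: GiG|exact: one_halfK].
Qed.

Lemma ev_metric_entry x i j : po_set D x -> ev x (metric_mx i j) = G x i j.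
Proof. by move=> Dx; rewrite -(ev_metric_mx Dx) [RHS]mxE. Qed.

Lemma ev_chris x k i j : po_set D x -> ev x (Gam k i j) = christoffel G k i j x.
Proof.
move=> Dx; rewrite /chris evM ev_sum /christoffel; congr (_ * _).
have dG a b c : ev x (dp a (metric_mx b c)) = partial (fun y => G y b c) a x.
  rewrite -[LHS]/(dp a (metric_mx b c) x) (dpartE _ _ Dx).
  by apply: (eq_partial _ (po_open D) Dx) => y; exact: ev_metric_entry.
apply: eq_bigr => l _; rewrite evM evB evD !dG; congr (_ * _).
by rewrite -(ev_Gi Dx) mxE.
Qed.

(** Links the abstract curvature to the coordinate formula for its components. *)
Lemma ev_curv_op_delta x l i j k : po_set D x ->
  ev x (curv_op nab (delta_mx 0 i) (delta_mx 0 j) (delta_mx 0 k) 0 l) =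
  riem G l i j k x.
Proof.
move=> Dx.
rewrite (curv_op_delta (@dpartD _ _ D) (@dpartM _ _ D) Gi one_half metric_mx_sym).
have dGam a b c e : ev x (dp a (Gam b c e)) = partial (christoffel G b c e) a x.
  rewrite -[LHS]/(dp a (Gam b c e) x) (dpartE _ _ Dx).
  by apply: (eq_partial _ (po_open D) Dx) => y; exact: ev_chris.
rewrite evD evB !dGam ev_sum; congr (_ + _).
apply: eq_bigr => m _; rewrite evB (evM x (Gam l i m)) (evM x (Gam l j m)).
by rewrite !(ev_chris _ _ _ Dx).
Qed.

Lemma innerE x u v : inner G x u v = \sum_i \sum_j u 0 i * v 0 j * G x i j.
Proof.
rewrite /inner mxE exchange_big; apply: eq_bigr => j _; rewrite mxE mulr_suml.
by apply: eq_bigr => i _; rewrite mxE; ring.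
Qed.

Lemma ev_gm x X Y : po_set D x -> ev x (gm X Y) = inner G x (evV x X) (evV x Y).
Proof.
move=> Dx; rewrite innerE ev_sum; apply: eq_bigr => i _.
rewrite ev_sum; apply: eq_bigr => j _.
by rewrite !evM ev_metric_entry// !mxE.
Qed.

Let LC := local_levi_civita.

Lemma ev_Rm x X Y Z W : po_set D x -> ev x (Rm nab gm X Y Z W) =
  inner G x (curvature G x (evV x X) (evV x Y) (evV x Z)) (evV x W).
Proof.
move=> Dx; have [t1 t2 t3 t4] := Rm_mlin LC.
rewrite (ev_lin1 _ _ (t1 _ _ _)) innerE.
transitivity (\sum_i \sum_j \sum_k evV x X 0 i * evV x Y 0 j * evV x Z 0 k *
    \sum_l \sum_m riem G l i j k x * evV x W 0 m * G x l m).
  apply: eq_bigr => i _; rewrite (ev_lin1 _ _ (t2 _ _ _)) mulr_sumr.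
  apply: eq_bigr => j _; rewrite (ev_lin1 _ _ (t3 _ _ _)) mulrA mulr_sumr.
  apply: eq_bigr => k _; rewrite mulrA; congr (_ * _).
  rewrite /Rm ev_gm// innerE; apply: eq_bigr => l _; apply: eq_bigr => m _.
  by rewrite [X in X * _ * _]mxE ev_curv_op_delta.
under eq_bigr => i _ do under eq_bigr => j _ do under eq_bigr => k _ do
  rewrite mulr_sumr.
under eq_bigr => i _ do under eq_bigr => j _ do rewrite exchange_big.
under eq_bigr => i _ do rewrite exchange_big.
rewrite exchange_big; apply: eq_bigr => l _ /=.
under eq_bigr => i _ do under eq_bigr => j _ do under eq_bigr => k _ do
  rewrite mulr_sumr.
under eq_bigr => i _ do under eq_bigr => j _ do rewrite exchange_big.
under eq_bigr => i _ do rewrite exchange_big.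
rewrite exchange_big; apply: eq_bigr => m _ /=.
rewrite [X in _ = X * _ * _]mxE !mulr_suml; apply: eq_bigr => i _.
rewrite !mulr_suml; apply: eq_bigr => j _.
by rewrite !mulr_suml; apply: eq_bigr => k _; ring.
Qed.

Definition curv4 x u v w z := inner G x (curvature G x u v w) z.

Lemma tensor_at_Rm x u v w z : po_set D x -> tensor_at x (Rm nab gm) u v w z = curv4 x u v w z.
Proof. by move=> Dx; rewrite /tensor_at ev_Rm// !evV_cstV. Qed.

Lemma two_torsion_free (a : A) : a + a = 0 -> a = 0.
Proof.
move=> aa; apply: smooth_funP => x Dx; apply: real_addrr_eq0.
by rewrite -[LHS]/(ev x (a + a)) aa.
Qed.

Lemma curv4_mlin x : po_set D x -> mlin4 (curv4 x).
Proof.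
move=> Dx; have [t1 t2 t3 t4] := tensor_at_mlin x (Rm_mlin LC).
split=> p q r a u v; rewrite -!tensor_at_Rm//.
- exact: t1.
- exact: t2.
- exact: t3.
- exact: t4.
Qed.

Lemma curv4_sym x : po_set D x -> curv_sym (curv4 x).
Proof.
move=> Dx; have [s12 s34 b] := tensor_at_curv x (Rm_curv LC two_torsion_free).
by split=> u v w z; rewrite -!(tensor_at_Rm _ _ _ _ Dx);
  [apply: s12|apply: s34|apply: b].
Qed.

Lemma inner_bilin x : bilin (inner G x).
Proof.
split=> [v a u u'|v a u u']; rewrite /inner.
  by rewrite !mulmxDl -!scalemxAl mxE [X in X + _]mxE.
by rewrite linearD linearZ /= mulmxDr -scalemxAr mxE [X in X + _]mxE.
Qed.

Lemma innerC x u v : po_set D x -> inner G x u v = inner G x v u.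
Proof.
move=> Dx; rewrite /inner -[u *m G x *m v^T]trmxK [LHS]mxE.
by rewrite !trmx_mul trmxK symG// mulmxA.
Qed.

(** The inverse metric in the trace cancels the metric in [curv4], and the trace of an
endomorphism in the coordinate basis is what remains. *)
Lemma ricci_trace x y z : po_set D x ->
  \sum_i \sum_l invmx (G x) i l * curv4 x (delta_mx 0 i) y z (delta_mx 0 l) =
  \sum_j \sum_k y 0 j * z 0 k * ricci G x j k.
Proof.
move=> Dx; have Gu : G x \in unitmx by apply: unit_posdef => u; exact: posG.
transitivity (\sum_i curvature G x (delta_mx 0 i) y z 0 i).
  apply: eq_bigr => i _; set v := curvature _ _ _ _ _.
  transitivity ((v *m G x *m invmx (G x)) 0 i); last by rewrite mulmxK.
  rewrite [RHS]mxE; apply: eq_bigr => l _; rewrite mulrC; congr (_ * _).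
    by rewrite /curv4 /inner trmx_delta -colE mxE.
  have : (invmx (G x))^T = invmx (G x) by rewrite trmx_inv symG.
  by move=> /matrixP/(_ i l); rewrite mxE.
under [RHS]eq_bigr => j _ do under eq_bigr => k _ do rewrite mxE mulr_sumr.
under [RHS]eq_bigr => j _ do rewrite exchange_big.
rewrite [RHS]exchange_big; apply: eq_bigr => i _ /=.
rewrite mxE (bigD1 i)//= [X in _ + X]big1 ?addr0 => [|i' i'i].
  apply: eq_bigr => j _; apply: eq_bigr => k _.
  by rewrite mxE !eqxx mul1r.
apply: big1 => j _; apply: big1 => k _.
by rewrite mxE (negbTE i'i) andbF !mul0r.
Qed.

Section Einstein.
Variable alpha : R.
Hypothesis einsteinG : forall x, po_set D x -> ricci G x = alpha *: G x.

Lemma einstein_trace x y z : po_set D x ->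
  \sum_i \sum_l invmx (G x) i l * curv4 x (delta_mx 0 i) y z (delta_mx 0 l) =
  alpha * inner G x y z.
Proof.
move=> Dx; rewrite ricci_trace// innerE mulr_sumr; apply: eq_bigr => j _.
rewrite mulr_sumr; apply: eq_bigr => k _.
by rewrite einsteinG// mxE; ring.
Qed.

Lemma ric_Rm b c : ric (fun i => delta_mx 0 i) Gi (Rm nab gm) b c =
  cst_smooth D alpha * gm b c.
Proof.
apply: smooth_funP => x Dx.
rewrite -[RHS]/(alpha * ev x (gm b c)) ev_gm// -einstein_trace//.
rewrite -[LHS]/(ev x _) /ric /gtrace ev_sum; apply: eq_bigr => i _.
rewrite ev_sum; apply: eq_bigr => l _.
rewrite evM ev_Rm// -(ev_Gi Dx) [in RHS]mxE; congr (_ * inner _ _ _ _).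
  by rewrite -!cstV_delta !evV_cstV.
by rewrite -cstV_delta evV_cstV.
Qed.

End Einstein.

End LocalMetric.

(** * The second derivative test along lines *)

Section SecondDerivative.
Context {R : realType} {n : nat} (D : pointed_open R n).
Local Notation A := (smooth_fun D).
Local Notation act := (fderiv (@dpart R n D)).

Lemma is_derive_smooth_line (f : A) w x (t : R) : po_set D (t *: w + x) ->
  is_derive t 1 (fun s : R => f (s *: w + x)) (ev (t *: w + x) (act (cstV D w) f)).
Proof.
move=> Dt; apply: is_derive_line.
have -> : ev (t *: w + x) (act (cstV D w) f) =
    \sum_i w 0 i * partial f i (t *: w + x).
  rewrite ev_sum; apply: eq_bigr => i _; rewrite evM mxE; congr (_ * _).
  exact: dpartE.
exact: is_derive_Ck_on (po_open D) Dt (smooth_fun_on f 1).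
Qed.

Lemma MVT_smooth_line (f : A) w x (b : R) : 0 < b ->
  (forall s, 0 <= s <= b -> po_set D (s *: w + x)) ->
  exists2 c, 0 < c < b &
    f (b *: w + x) - f x = ev (c *: w + x) (act (cstV D w) f) * b.
Proof.
move=> b0 Ds.
have [||c] := @MVT R (fun s => f (s *: w + x))
    (fun s => ev (s *: w + x) (act (cstV D w) f)) 0 b b0.
- move=> s; rewrite in_itv /= => /andP[s0 sb].
  by apply: is_derive_smooth_line; apply: Ds; rewrite !ltW.
- apply: continuous_in_subspaceT => s; rewrite inE /= in_itv /= => sb.
  have [fd _] := is_derive_smooth_line f (Ds _ sb).
  exact/differentiable_continuous/derivable1_diffP.
by rewrite scale0r add0r subr0 in_itv /= => cb E; exists c.
Qed.

Lemma open_segment (U : set 'rV[R]_n) x w : open U -> U x ->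
  exists2 r : R, 0 < r & forall s, `|s| < r -> U (s *: w + x).
Proof.
move=> oU Ux.
have [e /= e0 eU] := (nbhs_ballP x U).1 (open_nbhs_nbhs (conj oU Ux)).
have w0 : 0 < `|w| + 1 by rewrite ltr_wpDl.
exists (e / (`|w| + 1)); first exact: divr_gt0.
move=> s; rewrite ltr_pdivlMr// => sw; apply: eU; rewrite -ball_normE /=.
rewrite opprD addrCA subrr addr0 normrN normrZ; apply: le_lt_trans sw.
by rewrite ler_wpM2l// lerDl.
Qed.

(** The first derivative vanishes at an interior minimum.  If the second one were
negative, it would be so near x, and two applications of the mean value theorem
on the line through x would give a negative value of f. *)
Lemma second_derivative_test (f : A) w x : po_set D x ->
  (forall y, po_set D y -> 0 <= f y) -> f x = 0 ->
  ev x (act (cstV D w) f) = 0 /\ 0 <= ev x (act (cstV D w) (act (cstV D w) f)).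
Proof.
move=> Dx f_ge0 fx0.
have f1_eq0 : ev x (act (cstV D w) f) = 0.
  have [r r0 rD] := open_segment w (po_open D) Dx.
  have D0 : po_set D (0 *: w + x) by rewrite scale0r add0r.
  have Nrr : - r < r by lra.
  have min0 : is_derive (0 : R) 1 (fun s : R => f (s *: w + x)) 0.
    apply: (derive1_at_min (ltW Nrr)).
    - move=> t; rewrite in_itv /= => /andP[rt tr].
      have Dt : po_set D (t *: w + x) by apply: rD; rewrite ltr_norml rt.
      by have [] := is_derive_smooth_line f Dt.
    - by rewrite in_itv /=; apply/andP; split; lra.
    - move=> t; rewrite in_itv /= => /andP[rt tr].
      rewrite scale0r add0r fx0; apply: f_ge0; apply: rD.
      by rewrite ltr_norml rt.
  have [_ <-] := min0; have [_ ->] := is_derive_smooth_line f D0.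
  by rewrite scale0r add0r.
split => //; rewrite leNgt; apply/negP => f2_lt0.
set f1 := act (cstV D w) f in f1_eq0 f2_lt0.
set f2 := act (cstV D w) f1 in f2_lt0.
have f2c : {for x, continuous f2} by have [+ _] := smooth_fun_on f2 0; apply.
have nD : nbhs x (po_set D) := open_nbhs_nbhs (conj (po_open D) Dx).
have nf2 : nbhs x (fun y => f2 y < 0) by exact: (cvgr_lt _ f2c _ f2_lt0).
have [e /= e0 eP] := (nbhs_ballP x _).1 (filterI nD nf2).
have [r r0 rP] := open_segment w (@ball_open _ _ x e) (ballxx x e0).
have [||c /andP[c0 cr] E1] := @MVT_smooth_line f w x (r / 2); first lra.
  move=> s /andP[s0 sr]; have [] // := eP (s *: w + x).
  by apply: rP; rewrite ger0_norm//; lra.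
have [||c' /andP[c'0 c'c] E2] := @MVT_smooth_line f1 w x c; first by [].
  move=> s /andP[s0 sr]; have [] // := eP (s *: w + x).
  by apply: rP; rewrite ger0_norm//; lra.
have inP s : 0 <= s <= r / 2 -> ball x e (s *: w + x).
  by move=> /andP[s0 sr]; apply: rP; rewrite ger0_norm//; lra.
have [fD _] : po_set D (r / 2 *: w + x) /\ f2 (r / 2 *: w + x) < 0.
  by apply: eP; apply: inP; apply/andP; split; lra.
have [_ f2c'] : po_set D (c' *: w + x) /\ f2 (c' *: w + x) < 0.
  by apply: eP; apply: inP; apply/andP; split; lra.
have := f_ge0 _ fD; rewrite -[f (_ + _)](subrK (f x)) E1 fx0 addr0.
rewrite -[ev _ _](subrK (f1 x)) [X in X + _]E2.
rewrite (_ : f1 x = 0)// addr0 leNgt => /negP; apply.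
by rewrite pmulr_llt0 ?pmulr_llt0//; lra.
Qed.

End SecondDerivative.

(** * The Hessian of the curvature at a minimum *)

Section MinimumPrinciple.
Context {R : realType} {n : nat} (D : pointed_open R n).
Local Notation A := (smooth_fun D).
Variables (G Gi : 'M[A]_n) (half : A).
Local Notation dp := (@dpart R n D).
Local Notation act := (fderiv dp).
Local Notation Gam := (chris dp G Gi half).
Local Notation nab := (cov dp G Gi half).
Local Notation gm := (gmetric G).
Hypothesis LC : levi_civita act nab gm.

Section ParallelField.
Variables (x0 : 'rV[R]_n) (Dx0 : po_set D x0).

(** The affine field with value u at x0 and vanishing covariant derivative there: its
first derivatives cancel the Christoffel terms at x0.  On a curved manifold there
are in general no fields that are parallel near x0. *)
Definition parallel_field (u : 'rV[R]_n) : 'rV[A]_n := \row_k (cst_smooth D (u 0 k) -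
  \sum_i cst_smooth D (\sum_j u 0 j * ev x0 (Gam k i j)) *
    (coordf D i - cst_smooth D (x0 0 i))).

Lemma evV_parallel_field u : evV x0 (parallel_field u) = u.
Proof.
apply/rowP => k; rewrite !mxE evB ev_sum big1 ?subr0// => i _.
rewrite evM evB; have -> : ev x0 (coordf D i) = x0 0 i by exact: smooth_fun_ofE.
by rewrite subrr mulr0.
Qed.

Lemma dpart_sum i I (r : seq I) (F : I -> A) :
  dp i (\sum_(j <- r) F j) = \sum_(j <- r) dp i (F j).
Proof.
by apply: (big_morph _ (@dpartD _ _ D i)); exact: (derivation0 (@dpartD _ _ D)).
Qed.

Lemma dpartB i (f h : A) : dp i (f - h) = dp i f - dp i h.
Proof. by apply/eqP; rewrite -subr_eq0 opprB addrA -dpartD subrK subrr. Qed.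

Lemma evV_nab_parallel_field P u : evV x0 (nab P (parallel_field u)) = 0.
Proof.
apply/rowP => k; rewrite mxE [RHS]mxE.
have nabl : lin1 (fun P => nab P (parallel_field u) 0 k).
  by move=> a X Y; rewrite (nabL LC) !mxE.
rewrite (ev_lin1 _ _ nabl); apply: big1 => a _; apply/eqP; rewrite mulf_eq0.
apply/orP; right; apply/eqP.
rewrite cov_deltaE evD ev_sum [X in dp a X]mxE dpartB dpart_cst_smooth dpart_sum.
rewrite sub0r evN ev_sum.
have dE i : dp a (cst_smooth D (\sum_j u 0 j * ev x0 (Gam k i j)) *
    (coordf D i - cst_smooth D (x0 0 i))) =
    cst_smooth D (\sum_j u 0 j * ev x0 (Gam k i j)) * (a == i)%:R.
  by rewrite dpartM dpart_cst_smooth mul0r add0r dpartB dpart_cst_smooth subr0 dpart_coordf.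
under eq_bigr => i _ do rewrite dE.
rewrite (bigD1 a isT) [X in - (_ + X)]big1 ?addr0 => [|i /andP[_ ia]]; last first.
  by rewrite eq_sym (negbTE ia) mulr0.
rewrite eqxx mulr1 addrC; apply/eqP; rewrite subr_eq0; apply/eqP.
rewrite ev_cst_smooth; apply: eq_bigr => j _; rewrite evM; congr (_ * _).
by have /rowP/(_ j) := evV_parallel_field u; rewrite mxE.
Qed.

End ParallelField.

Lemma act_tensor P T a b c d : act P (T a b c d) = covd act nab P T a b c d
  + T (nab P a) b c d + T a (nab P b) c d + T a b (nab P c) d + T a b c (nab P d).
Proof. by rewrite /covd; ring. Qed.

Lemma ev_act_tensor x P T a b c d : ev x (act P (T a b c d)) =
  ev x (covd act nab P T a b c d) + ev x (T (nab P a) b c d) +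
  ev x (T a (nab P b) c d) + ev x (T a b (nab P c) d) + ev x (T a b c (nab P d)).
Proof. by rewrite act_tensor. Qed.

Lemma ev_hess x P Q T a b c d : ev x (hess act nab P Q T a b c d) =
  ev x (covd act nab P (covd act nab Q T) a b c d)
  - ev x (covd act nab (nab P Q) T a b c d).
Proof. exact: evB. Qed.

Lemma ev_lin1_eq0 x (f : 'rV[A]_n -> A) X : lin1 f -> evV x X = 0 -> ev x (f X) = 0.
Proof.
move=> fL X0; rewrite (ev_lin1 _ _ fL) X0; apply: big1 => i _.
by rewrite mxE mul0r.
Qed.

(** On fields X and Y which are parallel at x0, the second derivative of T(X, Y, Y, X)
differs from the second covariant derivative of T only by terms where X or Y is
differentiated.  Those with a single derivative vanish because the fields are
parallel at x0, those with a second derivative of X or Y because T(u, v, v, u) = 0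
is critical in each argument. *)
Lemma hess_ge0_at_min T x0 u v w : mlin4 T -> po_set D x0 ->
    (forall x X Y, po_set D x -> 0 <= ev x (T X Y Y X)) ->
    tensor_at x0 T u v v u = 0 ->
    (forall z, [/\ tensor_at x0 T z v v u = 0, tensor_at x0 T u z v u = 0,
                   tensor_at x0 T u v z u = 0 & tensor_at x0 T u v v z = 0]) ->
  0 <= tensor_at x0 (hess act nab (cstV D w) (cstV D w) T) u v v u.
Proof.
move=> TL Dx0 Tpos T0 Tz.
set P := cstV D w; set X := parallel_field x0 u; set Y := parallel_field x0 v.
have Xu : evV x0 X = u := evV_parallel_field Dx0 u.
have Yv : evV x0 Y = v := evV_parallel_field Dx0 v.
have nX Q : evV x0 (nab Q X) = 0 := evV_nab_parallel_field Dx0 Q u.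
have nY Q : evV x0 (nab Q Y) = 0 := evV_nab_parallel_field Dx0 Q v.
pose f := T X Y Y X.
have fx0 : ev x0 f = 0 by rewrite /f ev_tensor// Xu Yv.
have f_ge0 x : po_set D x -> 0 <= f x by exact: Tpos.
have [_ fww] := second_derivative_test w Dx0 f_ge0 fx0.
have df Q : ev x0 (act Q f) = 0.
  rewrite (ev_lin1_cst _ _ (fderivL dp f)).
  by have [] := second_derivative_test (evV x0 Q) Dx0 f_ge0 fx0.
have van (S : 'rV[A]_n -> 'rV[A]_n -> 'rV[A]_n -> 'rV[A]_n -> A) : mlin4 S -> forall a b c d,
    [\/ evV x0 a = 0, evV x0 b = 0, evV x0 c = 0 | evV x0 d = 0] ->
    ev x0 (S a b c d) = 0.
  move=> [s1 s2 s3 s4] a b c d [] h; [exact: (ev_lin1_eq0 (s1 b c d) h)|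
    exact: (ev_lin1_eq0 (s2 a c d) h)|exact: (ev_lin1_eq0 (s3 a b d) h)|
    exact: (ev_lin1_eq0 (s4 a b c) h)].
have covT Q : ev x0 (covd act nab Q T X Y Y X) = 0.
  have := df Q; rewrite /f ev_act_tensor.
  rewrite (van T TL _ Y Y X (Or41 _ _ _ (nX Q))) (van T TL X _ Y X (Or42 _ _ _ (nY Q))).
  rewrite (van T TL X Y _ X (Or43 _ _ _ (nY Q))) (van T TL X Y Y _ (Or44 _ _ _ (nX Q))).
  by rewrite !addr0.
have CL := covd_mlin LC P TL.
have v1 S : mlin4 S -> forall Q b c d, ev x0 (S (nab Q X) b c d) = 0.
  by move=> SL Q b c d; apply: van => //; apply: Or41; exact: nX.
have v2 S : mlin4 S -> forall Q a c d, ev x0 (S a (nab Q Y) c d) = 0.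
  by move=> SL Q a c d; apply: van => //; apply: Or42; exact: nY.
have v3 S : mlin4 S -> forall Q a b d, ev x0 (S a b (nab Q Y) d) = 0.
  by move=> SL Q a b d; apply: van => //; apply: Or43; exact: nY.
have v4 S : mlin4 S -> forall Q a b c, ev x0 (S a b c (nab Q X)) = 0.
  by move=> SL Q a b c; apply: van => //; apply: Or44; exact: nX.
have g0 S : mlin4 S ->
    ev x0 (act P (S X Y Y X)) = ev x0 (covd act nab P S X Y Y X).
  move=> SL; rewrite ev_act_tensor (v1 _ SL P Y Y X) (v2 _ SL P X Y X).
  by rewrite (v3 _ SL P X Y X) (v4 _ SL P X Y Y) !addr0.
have a0 := g0 _ CL.
(* a1 to a4: the derivatives of the four terms of P f in which P falls on an
   argument; only a second derivative of X or Y remains, in a slot where T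
   vanishes. *)
have a1 : ev x0 (act P (T (nab P X) Y Y X)) = 0.
  have := ev_tensor x0 (nab P (nab P X)) Y Y X TL; rewrite Xu Yv => Tpp.
  rewrite ev_act_tensor (v1 _ CL P Y Y X) (v2 _ TL P (nab P X) Y X).
  rewrite (v3 _ TL P (nab P X) Y X) (v4 _ TL P (nab P X) Y Y) Tpp.
  by have [-> _ _ _] := Tz (evV x0 (nab P (nab P X))); rewrite !addr0.
have a2 : ev x0 (act P (T X (nab P Y) Y X)) = 0.
  have := ev_tensor x0 X (nab P (nab P Y)) Y X TL; rewrite Xu Yv => Tpp.
  rewrite ev_act_tensor (v2 _ CL P X Y X) (v1 _ TL P (nab P Y) Y X).
  rewrite (v3 _ TL P X (nab P Y) X) (v4 _ TL P X (nab P Y) Y) Tpp.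
  by have [_ -> _ _] := Tz (evV x0 (nab P (nab P Y))); rewrite !addr0.
have a3 : ev x0 (act P (T X Y (nab P Y) X)) = 0.
  have := ev_tensor x0 X Y (nab P (nab P Y)) X TL; rewrite Xu Yv => Tpp.
  rewrite ev_act_tensor (v3 _ CL P X Y X) (v1 _ TL P Y (nab P Y) X).
  rewrite (v2 _ TL P X (nab P Y) X) (v4 _ TL P X Y (nab P Y)) Tpp.
  by have [_ _ -> _] := Tz (evV x0 (nab P (nab P Y))); rewrite !addr0.
have a4 : ev x0 (act P (T X Y Y (nab P X))) = 0.
  have := ev_tensor x0 X Y Y (nab P (nab P X)) TL; rewrite Xu Yv => Tpp.
  rewrite ev_act_tensor (v4 _ CL P X Y Y) (v1 _ TL P Y Y (nab P X)).
  rewrite (v2 _ TL P X Y (nab P X)) (v3 _ TL P X Y (nab P X)) Tpp.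
  by have [_ _ _ ->] := Tz (evV x0 (nab P (nab P X))); rewrite !addr0.
have hE : tensor_at x0 (hess act nab P P T) u v v u =
    ev x0 (covd act nab P (covd act nab P T) X Y Y X).
  have := ev_tensor x0 X Y Y X (hess_mlin LC P P TL); rewrite Xu Yv => <-.
  by rewrite ev_hess (covT (nab P P)) subr0.
have fE : act P f = covd act nab P T X Y Y X
  + T (nab P X) Y Y X + T X (nab P Y) Y X + T X Y (nab P Y) X + T X Y Y (nab P X).
  exact: act_tensor.
suff -> : tensor_at x0 (hess act nab P P T) u v v u = ev x0 (act P (act P f)) by [].
have actE (p q r s t : A) : ev x0 (act P (p + q + r + s + t)) = ev x0 (act P p)
    + ev x0 (act P q) + ev x0 (act P r) + ev x0 (act P s) + ev x0 (act P t).
  by rewrite !(actD LC P).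
rewrite hE fE actE a0 a1 a2 a3 a4.
by move: (ev x0 _) => r; rewrite !addr0.
Qed.

End MinimumPrinciple.

(** * Rigidity in a chart *)

Section LocalRigidity.
Context {R : realType} {n : nat} (D : pointed_open R n).
Variable G : 'rV[R]_n -> 'M[R]_n.
Hypothesis smoothG : forall a b, smooth_on D (fun x => G x a b).
Hypothesis symG : forall x, po_set D x -> (G x)^T = G x.
Hypothesis posG : forall x (u : 'rV[R]_n), po_set D x -> u != 0 ->
  0 < (u *m G x *m u^T) 0 0.
Variables (alpha delta : R).
Hypothesis einsteinG : forall x, po_set D x -> ricci G x = alpha *: G x.

Variable Gi : 'M[smooth_fun D]_n.
Hypothesis GiG : Gi *m metric_mx smoothG = 1%:M.

Let gram2 x u v := inner G x u u * inner G x v v - inner G x u v ^+ 2.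
Hypothesis sec_ge : forall x u v, po_set D x ->
  delta * gram2 x u v <= curv4 G x u v v u.

(** The excess of the curvature over constant curvature delta; this is the T of the
algebraic part. *)
Definition curv_defect x u v w z :=
  curv4 G x u v w z + (- delta) * const_curv (inner G x) u v w z.

Let tau := alpha - (n%:R - 1) * delta.

Lemma defect_mlin x : po_set D x -> mlin4 (curv_defect x).
Proof. by move=> Dx; exact: mlin4_shift (inner_bilin G x) (curv4_mlin symG GiG Dx). Qed.

Lemma defect_curv x : po_set D x -> curv_sym (curv_defect x).
Proof.
move=> Dx; apply: curv_sym_shift (curv4_sym symG GiG Dx) => u v.
exact: (innerC symG u v Dx).
Qed.

Lemma defect_ge0 x u v : po_set D x -> 0 <= curv_defect x u v v u.
Proof.
move=> Dx; have := sec_ge u v Dx; rewrite /curv_defect /const_curv /gram2.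
by rewrite (innerC symG v u Dx) expr2 mulNr subr_ge0 [inner G x v v * _]mulrC.
Qed.

(** The trace of the constant curvature tensor in dimension n is (n - 1) g, hence the
value of tau. *)
Lemma defect_frame x : po_set D x -> exists E : 'I_n -> 'rV[R]_n,
  (forall u, u = \sum_a inner G x u (E a) *: E a) /\
  (forall y z, \sum_a curv_defect x (E a) y z (E a) = tau * inner G x y z) /\
  (forall F, bilin F ->
    \sum_i \sum_l invmx (G x) i l * F (delta_mx 0 i) (delta_mx 0 l) =
    \sum_a F (E a) (E a)).
Proof.
move=> Dx; have [E [frame E1 tr]] :=
  orthonormal_frame (symG Dx) (fun u => posG (u := u) Dx).
exists E; split=> //; split=> // y z.
have [t1 t2 t3 t4] := curv4_mlin symG GiG Dx.
have iL := (inner_bilin G x).2 y.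
rewrite big_split -mulr_sumr /=.
rewrite -(tr (fun a d => curv4 G x a y z d) (conj (t1 y z) (fun a => t4 a y z))).
rewrite (einstein_trace symG posG einsteinG _ _ Dx).
rewrite /const_curv sumrB -mulr_sumr.
have -> : \sum_a inner G x (E a) (E a) = n%:R.
  by rewrite (eq_bigr _ (fun a _ => E1 a)) sumr_const card_ord.
have -> : \sum_a inner G x (E a) z * inner G x y (E a) = inner G x y z.
  rewrite -[RHS](frame_sum (e := E) (g := inner G x) frame z iL).
  by apply: eq_bigr => a _; rewrite (innerC symG (E a) z Dx).
by rewrite /tau; ring.
Qed.

(** This is [zero_trace_flat] at each point. *)
Lemma constant_of_trace0 : tau = 0 -> forall x u v, po_set D x ->
  curv4 G x u v v u = delta * gram2 x u v.
Proof.
move=> tau0 x u v Dx; have [E [frame [tr _]]] := defect_frame Dx.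
have := zero_trace_flat frame (defect_mlin Dx) (defect_curv Dx) tr
  (fun x' y => defect_ge0 x' y Dx) tau0 u v.
rewrite /curv_defect /const_curv (innerC symG v u Dx) /gram2 => /eqP.
by rewrite addr_eq0 => /eqP ->; ring.
Qed.

Local Notation A := (smooth_fun D).
Local Notation act := (fderiv (@dpart R n D)).
Local Notation nab := (cov (@dpart R n D) (metric_mx smoothG) Gi (one_half D)).
Local Notation gm := (gmetric (metric_mx smoothG)).
Local Notation RmA := (Rm nab gm).

Let LC : levi_civita act nab gm := local_levi_civita symG GiG.

Let defect_field (a b c d : 'rV[A]_n) : A :=
  RmA a b c d + cst_smooth D (- delta) * const_curv gm a b c d.

Lemma act_cst_smooth X c : act X (cst_smooth D c) = 0.
Proof. by apply: big1 => i _; rewrite dpart_cst_smooth mulr0. Qed.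

Lemma defect_field_mlin : mlin4 defect_field.
Proof. exact: mlin4_shift (metric_bilin LC) (Rm_mlin LC). Qed.

Lemma tensor_at_defect_field x u v w z : po_set D x ->
  tensor_at x defect_field u v w z = curv_defect x u v w z.
Proof.
move=> Dx; rewrite /curv_defect -(tensor_at_Rm symG GiG _ _ _ _ Dx).
have cE : tensor_at x (const_curv gm) u v w z = const_curv (inner G x) u v w z.
  have evE (a b c d : A) : ev x (a * b - c * d) = ev x a * ev x b - ev x c * ev x d by [].
  by rewrite /tensor_at /const_curv evE !(ev_gm smoothG _ _ Dx) !evV_cstV.
by rewrite -cE.
Qed.

Section AtMinimum.
Variables (x0 : 'rV[R]_n) (Dx0 : po_set D x0).
Variable E : 'I_n -> 'rV[R]_n.
Hypothesis frame : forall u, u = \sum_a inner G x0 u (E a) *: E a.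
Hypothesis frame_trace : forall F : 'rV[R]_n -> 'rV[R]_n -> R, bilin F ->
    \sum_i \sum_l invmx (G x0) i l * F (delta_mx 0 i) (delta_mx 0 l) =
    \sum_a F (E a) (E a).

Definition hess_Rm p q := tensor_at x0 (hess act nab (cstV D p) (cstV D q) RmA).

Lemma hess_Rm_curv p q : curv_sym (hess_Rm p q).
Proof. exact: tensor_at_curv (hess_curv LC _ _ (Rm_curv LC (@two_torsion_free _ _ D))). Qed.

(** The trace over the frame at x0 is first rewritten with the inverse metric, so as
to be the value of a trace of tensor fields, which [ric_hess] computes. *)
Lemma hess_Rm_trace p q y z : \sum_a hess_Rm p q (E a) y z (E a) = 0.
Proof.
have [h1 h2 h3 h4] := tensor_at_mlin x0 (hess_mlin LC (cstV D p) (cstV D q) (Rm_mlin LC)).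
rewrite -(frame_trace (F := fun a d => hess_Rm p q a y z d)); last first.
  by split=> [d|a]; [exact: h1|exact: h4].
have gramE : \matrix_(i, j) gm (delta_mx 0 i) (delta_mx 0 j) = metric_mx smoothG.
  by apply/matrixP => i j; rewrite mxE gmetric_delta.
have := @ric_hess _ _ _ _ _ LC n (fun i => delta_mx 0 i) (fun X i => X 0 i) Gi
  (fun X => row_sum_delta X).
rewrite gramE => /(_ GiG (mulmx1C GiG) _ _ (Rm_mlin LC) (act_cst_smooth^~ alpha)).
move=> /(_ (ric_Rm symG posG GiG einsteinG) (cstV D p) (cstV D q) (cstV D y) (cstV D z)).
move=> /(congr1 (ev x0)); rewrite (rmorph0 (ev x0)) => tr0; apply: etrans tr0.
rewrite /ric /gtrace ev_sum; apply: eq_bigr => i _; rewrite ev_sum.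
apply: eq_bigr => l _.
have GiE : invmx (G x0) i l = ev x0 (Gi i l) by rewrite -(ev_Gi GiG Dx0) mxE.
have HE : hess_Rm p q (delta_mx 0 i) y z (delta_mx 0 l) = ev x0 (hess act nab
    (cstV D p) (cstV D q) RmA (delta_mx 0 i) (cstV D y) (cstV D z) (delta_mx 0 l)).
  by rewrite /hess_Rm /tensor_at !cstV_delta.
by rewrite GiE HE; move: (Gi i l) (hess _ _ _ _ _ _ _ _ _).
Qed.

Lemma hess_Rm_bianchi p a x y z w :
  hess_Rm p a x y z w + hess_Rm p x y a z w + hess_Rm p y a x z w = 0.
Proof.
have h := hess_bianchi2 LC (Rm_mlin LC) (Rm_bianchi2 LC) (cstV D p)
  (cstV D x) (cstV D y) (cstV D a) (cstV D z) (cstV D w).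
by have := congr1 (ev x0) h; rewrite 2!evD (rmorph0 (ev x0)).
Qed.

Lemma hess_defect_field p q x y z w :
  tensor_at x0 (hess act nab (cstV D p) (cstV D q) defect_field) x y z w =
  hess_Rm p q x y z w.
Proof. by rewrite /hess_Rm /tensor_at /defect_field hess_shift// => Z; exact: act_cst_smooth. Qed.

(** In the Ricci identity, the curvature operators applied to the arguments are
expanded in the orthonormal frame. *)
Lemma hess_Rm_ricci p q x y z w : hess_Rm p q x y z w - hess_Rm q p x y z w =
  - \sum_m (curv4 G x0 p q x (E m) * curv_defect x0 (E m) y z w +
             curv4 G x0 p q y (E m) * curv_defect x0 x (E m) z w +
             curv4 G x0 p q z (E m) * curv_defect x0 x y (E m) w +
             curv4 G x0 p q w (E m) * curv_defect x0 x y z (E m)).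
Proof.
have curvE a m : curv4 G x0 p q a (E m) =
    inner G x0 (evV x0 (curv_op nab (cstV D p) (cstV D q) (cstV D a))) (E m).
  rewrite -(tensor_at_Rm symG GiG _ _ _ _ Dx0) /tensor_at /Rm (ev_gm smoothG _ _ Dx0).
  by rewrite evV_cstV.
have [d1 d2 d3 d4] := defect_mlin Dx0.
rewrite !big_split /=.
under eq_bigr do rewrite curvE.
rewrite (frame_sum frame _ (d1 y z w)).
under eq_bigr do rewrite curvE.
rewrite (frame_sum frame _ (d2 x z w)).
under eq_bigr do rewrite curvE.
rewrite (frame_sum frame _ (d3 x y w)).
under eq_bigr do rewrite curvE.
rewrite (frame_sum frame _ (d4 x y z)).
have tE a b c d : ev x0 (defect_field a b c d) =
    curv_defect x0 (evV x0 a) (evV x0 b) (evV x0 c) (evV x0 d).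
  by rewrite -(tensor_at_defect_field _ _ _ _ Dx0); exact: (ev_tensor x0 a b c d defect_field_mlin).
have evE (a b c d : A) : ev x0 (- (a + b + c + d)) =
  - (ev x0 a + ev x0 b + ev x0 c + ev x0 d) by [].
have h := congr1 (ev x0) (hess_ricci LC (cstV D p) (cstV D q)
  (cstV D x) (cstV D y) (cstV D z) (cstV D w) defect_field_mlin).
rewrite -(hess_defect_field p q) -(hess_defect_field q p) /tensor_at.
apply: etrans (etrans _ h) _.
  by move: (hess _ _ _ _ _ _ _ _ _) (hess _ _ _ _ _ _ _ _ _).
move: (curv_op nab _ _ (cstV D x)) (curv_op nab _ _ (cstV D y))
  (curv_op nab _ _ (cstV D z)) (curv_op nab _ _ (cstV D w)) => cx cy cz cw.
by rewrite evE !tE !evV_cstV.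
Qed.

End AtMinimum.

Lemma inner_ge0 x u : po_set D x -> 0 <= inner G x u u.
Proof.
move=> Dx; have [->|/(posG Dx)/ltW//] := eqVneq u 0.
by rewrite /inner !mul0mx mxE.
Qed.

(** The defect is unchanged, up to a positive factor, by the Gram-Schmidt process. *)
Lemma orthonormal_minimum x u v : po_set D x -> 0 < gram2 x u v ->
    curv_defect x u v v u = 0 ->
  exists u1 v1, [/\ inner G x u1 u1 = 1, inner G x v1 v1 = 1,
    inner G x u1 v1 = 0 & curv_defect x u1 v1 v1 u1 = 0].
Proof.
move=> Dx; have [g1 g2] := inner_bilin G x; have gC p q := innerC symG p q Dx.
have gDl a p q r : inner G x (a *: p + q) r = a * inner G x p r + inner G x q r := g1 r a p q.
have gDr a p q r : inner G x r (a *: p + q) = a * inner G x r p + inner G x r q := g2 r a p q.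
have gZl a p r : inner G x (a *: p) r = a * inner G x p r := lin1Z (g1 r) a p.
have gZr a p r : inner G x r (a *: p) = a * inner G x r p := lin1Z (g2 r) a p.
rewrite /gram2 => gram_gt0 Kuv.
have guu : 0 < inner G x u u.
  rewrite lt_neqAle inner_ge0// andbT eq_sym; apply/eqP => guu0.
  by move: gram_gt0; rewrite guu0 mul0r sub0r oppr_gt0 ltNge sqr_ge0.
pose c := - (inner G x u v / inner G x u u); pose v' := c *: u + v.
have guv' : inner G x u v' = 0.
  by rewrite /v' gDr /c mulNr divfK ?gt_eqF// addNr.
have gv'v' : 0 < inner G x v' v'.
  have -> : inner G x v' v' =
      (inner G x u u * inner G x v v - inner G x u v ^+ 2) / inner G x u u.
    rewrite {1}/v' gDl guv' mulr0 add0r /v' gDr (gC v u) /c.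
    by field; rewrite gt_eqF.
  exact: divr_gt0.
have Kuv' : curv_defect x u v' v' u = 0.
  have dL := defect_mlin Dx; have dC := defect_curv Dx.
  rewrite /v' (mlin4_2 dL) (curv_diag12 _ _ _ dC) mulr0 add0r (mlin4_3 dL) Kuv addr0.
  by rewrite (curv_diag34 _ _ _ dC) mulr0.
have nrm p : 0 < inner G x p p ->
    inner G x ((Num.sqrt (inner G x p p))^-1 *: p) ((Num.sqrt (inner G x p p))^-1 *: p) = 1.
  move=> gp; rewrite gZl gZr mulrA -expr2 exprVn sqr_sqrtr ?ltW// mulVf// gt_eqF//.
exists ((Num.sqrt (inner G x u u))^-1 *: u), ((Num.sqrt (inner G x v' v'))^-1 *: v').
split; [exact: nrm|exact: nrm|by rewrite gZl gZr guv' !mulr0|].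
have dL := defect_mlin Dx.
rewrite (lin1Z (mlin4_1 dL _ _ _)) (lin1Z (mlin4_2 dL _ _ _)).
by rewrite (lin1Z (mlin4_3 dL _ _ _)) (lin1Z (mlin4_4 dL _ _ _)) Kuv' !mulr0.
Qed.

(** [trace_eq0_of_pinching] for the values at x0 of the curvature defect and of its
second covariant derivative.  The conclusion is about constants: a single plane of
minimal curvature in one chart gives tau = 0, which can then be used in every
chart. *)
Lemma trace_eq0_at_minimum x0 u v : po_set D x0 -> 0 < gram2 x0 u v ->
  curv4 G x0 u v v u = delta * gram2 x0 u v -> tau < delta -> tau = 0.
Proof.
move=> Dx0 gram_gt0 Kuv tau_lt.
have Tuv0 : curv_defect x0 u v v u = 0.
  by rewrite /curv_defect /const_curv Kuv /gram2 (innerC symG v u Dx0); ring.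
have [u1 [v1 [guu gvv guv T0]]] := orthonormal_minimum Dx0 gram_gt0 Tuv0.
have [E [frame [tr ftr]]] := defect_frame Dx0.
have dL := defect_mlin Dx0; have dC := defect_curv Dx0.
have dpos y z := defect_ge0 y z Dx0.
have pair := curv_pair (@real_addrr_eq0 R) dC.
have T0' : curv_defect x0 v1 u1 u1 v1 = 0 by rewrite pair.
have z1 z : curv_defect x0 u1 v1 v1 z = 0 := zero_plane_contract dL dC dpos z T0.
have z2 z : curv_defect x0 v1 u1 u1 z = 0 := zero_plane_contract dL dC dpos z T0'.
apply: (@trace_eq0_of_pinching R _ (inner G x0) n E frame (fun p q => innerC symG p q Dx0)
  (curv_defect x0) (hess_Rm x0) delta tau dL dC tr dpos (hess_Rm_curv x0)
  (hess_Rm_trace Dx0 ftr) (hess_Rm_bianchi x0) _ u1 v1 guu gvv guv T0 _ tau_lt).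
- move=> p q x y z w; rewrite (hess_Rm_ricci Dx0 frame); congr (- _).
  have cE a b c d : curv4 G x0 a b c d =
      curv_defect x0 a b c d + delta * const_curv (inner G x0) a b c d.
    by rewrite /curv_defect; ring.
  by apply: eq_bigr => m _; rewrite !cE.
- move=> p; rewrite -hess_defect_field.
  apply: (hess_ge0_at_min LC p defect_field_mlin Dx0).
  + move=> x X Y Dx; rewrite (ev_tensor _ _ _ _ _ defect_field_mlin) tensor_at_defect_field//.
    exact: defect_ge0.
  + by rewrite tensor_at_defect_field.
  + move=> z; rewrite !tensor_at_defect_field//; split=> //.
    * by rewrite pair (curv_skew12 dC) (curv_skew34 dC) opprK z1.
    * by rewrite pair z2.
    * by rewrite (curv_skew12 dC) (curv_skew34 dC) opprK z2.
Qed.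

End LocalRigidity.

(** * Completeness of compact manifolds *)

Section Norms.
Context {R : realType} {n : nat}.

Lemma coord_le_norm (w : 'rV[R]_n) a : `|w 0 a| <= `|w|.
Proof.
rewrite [leRHS]/Num.Def.normr/= mx_normrE.
exact: (le_bigmax _ (fun ij : 'I_1 * 'I_n => `|w ij.1 ij.2|) (0, a)).
Qed.

Lemma inner_le (G : 'rV[R]_n -> 'M[R]_n) y w K :
  (forall a b, `|G y a b| <= K) -> inner G y w w <= (n * n)%:R * K * `|w| ^+ 2.
Proof.
move=> GK; rewrite innerE.
apply: (@le_trans _ _ (\sum_(i < n) \sum_(j < n) K * `|w| ^+ 2)).
  apply: ler_sum => i _; apply: ler_sum => j _.
  apply: le_trans (ler_norm _) _; rewrite !normrM mulrC; apply: ler_pM => //.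
  by rewrite expr2; apply: ler_pM; rewrite ?coord_le_norm.
rewrite !sumr_const card_ord -!mulrnA -mulr_natl mulrA; lra.
Qed.

Lemma is_derive_segment (w x : 'rV[R]_n) (t : R) :
  is_derive t 1 (fun s : R => s *: w + x) w.
Proof.
have lim : (fun h : R => h^-1 *: (((fun s : R => s *: w + x) \o shift t) (h *: (1 : R))
    - (t *: w + x))) @ 0^' --> w.
  apply: cvg_near_cst; near=> h.
  have h0 : h != 0 by near: h; exact: nbhs_dnbhs_neq.
  rewrite /= /shift/= -[h%:A]/(h * 1) mulr1 opprD addrACA subrr addr0.
  by rewrite -scalerBl addrK scalerA mulVf// scale1r.
by split; [apply/cvg_ex; exists w|exact/cvg_lim].
Unshelve. all: by end_near. Qed.

End Norms.

Section Completeness.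
Context {R : realType} {n : nat} (M : riemannianManifold R n).
Implicit Types p q r : M.

Lemma path_length_cat p q r (k l : R) :
  path_length p q k -> path_length q r l -> path_length p r (k + l).
Proof.
elim=> [p'|i c q' l' cC cimg _ IH] ql; first by rewrite add0r.
by rewrite -addrA; apply: path_cons => //; exact: IH.
Qed.

(** Along the straight segment from x to x0 the speed is constant in coordinates, and
a bound on the coefficients of the metric bounds its length.  To see that the
speed is integrable, it is written as the square root of a smooth function. *)
Lemma segment_path i (x0 x : 'rV[R]_n) (r K : R) :
  ball x0 r `<=` chart_img (mfd_chart (s := M) i) ->
  0 <= K -> (forall y a b, ball x0 r y -> `|metric i y a b| <= K) -> ball x0 r x ->
  exists2 l, path_length (chart_inv (mfd_chart i) x) (chart_inv (mfd_chart i) x0) l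
    & l <= Num.sqrt ((n * n)%:R * K) * `|x0 - x|.
Proof.
move=> ballimg K0 GK xball.
pose w := x0 - x; pose c (t : R) := t *: w + x.
have c0 : c 0 = x by rewrite /c scale0r add0r.
have c1 : c 1 = x0 by rewrite /c scale1r subrK.
have cD (t : R) : is_derive t 1 c w by exact: is_derive_segment.
have dc : c^`()%classic = fun=> w.
  by apply/funext => t; rewrite derive1E; have [_ ->] := cD t.
have cball t : 0 <= t <= 1 -> ball x0 r (c t).
  move=> /andP[t0 t1]; rewrite -ball_normE /=.
  have -> : x0 - c t = (1 - t) *: w.
    by rewrite scalerBl scale1r /c /w opprD addrA addrAC.
  rewrite normrZ ger0_norm ?subr_ge0//.
  apply: le_lt_trans (_ : `|w| < r); last by move: xball; rewrite -ball_normE.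
  by rewrite -[leRHS]mul1r ler_wpM2r// gerBl.
have C1c : C1_curve c.
  split; first by move=> t; have [] := cD t.
  by rewrite dc => t; exact: cst_continuous.
have := path_cons C1c (fun t t01 => ballimg _ (cball t t01))
  (path_nil (chart_inv (mfd_chart i) (c 1))).
rewrite c0 c1 addr0 => pl; exists (segment_length i c) => //.
pose D := PointedOpen (@chart_img_open _ _ _ (mfd_chart (s := M) i)) (ballimg x xball).
pose f := gmetric (metric_mx (D := D) (@metric_smooth _ _ M i))
  (cstV D w) (cstV D w).
have fE y : po_set D y -> f y = inner (metric i) y w w.
  move=> Dy; have := ev_gm (D := D) (@metric_smooth _ _ M i) (cstV D w) (cstV D w) Dy.
  by rewrite !evV_cstV.
pose h (t : R) := Num.sqrt (f (c t)).
have hcont : {within `[0, 1], continuous h}.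
  apply: continuous_in_subspaceT => t; rewrite inE /= in_itv /= => t01.
  apply: continuous_comp; last exact: sqrt_continuous.
  have [fd _] := is_derive_smooth_line f (ballimg _ (cball t t01)).
  exact/differentiable_continuous/derivable1_diffP.
pose C := Num.sqrt ((n * n)%:R * K) * `|w|.
have hC t : 0 <= t <= 1 -> h t <= C.
  move=> t01; have Dt := ballimg _ (cball t t01).
  have -> : C = Num.sqrt ((n * n)%:R * K * `|w| ^+ 2).
    by rewrite /C [RHS]sqrtrM ?sqrtr_sqr ?normr_id// mulr_ge0.
  rewrite /h ler_wsqrtr// fE//; apply: inner_le => a b.
  exact: GK (cball t t01).
have -> : segment_length i c = \int[lebesgue_measure]_(t in `[0, 1]) h t.
  apply: eq_Rintegral => t; rewrite inE /= in_itv /= => t01.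
  by rewrite dc /h fE//; exact: (ballimg _ (cball t t01)).
apply: le_trans (_ : \int[lebesgue_measure]_(t in `[(0 : R), 1]) C <= _).
  apply: le_Rintegral => //.
  - apply: continuous_compact_integrable => //; exact: segment_compact.
  - apply: continuous_compact_integrable; first exact: segment_compact.
    by apply: continuous_subspaceT => t; exact: cst_continuous.
rewrite Rintegral_cst//= lebesgue_measure_itv /= lte_fin ltr01 sube0 mulr1.
exact: lexx.
Qed.

(** The coefficients of the metric are bounded near the point by continuity, and
[segment_path] applies in a ball whose radius absorbs the bound. *)
Lemma short_path_near p (e : R) : 0 < e ->
  exists2 W, nbhs p W & forall q, W q -> exists2 l, path_length q p l & l < e.
Proof.
move=> e0; have [i pi] := mfd_cover p.
pose ch := mfd_chart (s := M) i; pose x0 := chart_map ch p.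
have x0img : chart_img ch x0 := chart_mapP pi.
pose K := \sum_a \sum_b `|metric i x0 a b| + 1.
have K0 : 0 < K by rewrite ltr_wpDl// sumr_ge0// => a _; rewrite sumr_ge0.
have nK : \forall y \near x0, forall a b, `|metric i y a b| <= K.
  apply: (@filter_forall _ _ (fun a y => forall b, `|metric i y a b| <= K) _
    (nbhs_filter x0)) => a.
  apply: (@filter_forall _ _ (fun b y => `|metric i y a b| <= K) _
    (nbhs_filter x0)) => b.
  have [Gc _] := @metric_smooth _ _ M i a b 0.
  have Gx : \forall y \near x0, `|metric i x0 a b - metric i y a b| < 1.
    exact: (cvgrPdist_lt _ _).1 (Gc x0 x0img) _ ltr01.
  apply: filterS Gx => y Gy.
  have GleK : `|metric i x0 a b| + 1 <= K.
    rewrite lerD2r (bigD1 a)//= (bigD1 b)//= -addrA lerDl addr_ge0// sumr_ge0//.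
    by move=> a' _; rewrite sumr_ge0.
  apply: le_trans GleK; rewrite -[metric i y a b](subKr (metric i x0 a b)).
  by rewrite (le_trans (ler_normB _ _))// lerD2l ltW.
have nimg : nbhs x0 (chart_img ch).
  by apply: open_nbhs_nbhs; split => //; exact: chart_img_open.
have [r /= r0 rP] := (nbhs_ballP x0 _).1 (filterI nimg nK).
pose B := Num.sqrt ((n * n)%:R * K).
have B0 : 0 <= B by exact: sqrtr_ge0.
pose rho := Num.min r (e / (B + 1)).
have B1 : 0 < B + 1 by rewrite ltr_wpDl.
have rho0 : 0 < rho by rewrite lt_min r0 divr_gt0.
have ballr : ball x0 rho `<=` ball x0 r.
  by apply: le_ball; rewrite ge_min lexx.
exists (chart_dom ch `&` (chart_map ch @^-1` ball x0 rho)).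
  have domp : nbhs p (chart_dom ch).
    by apply: open_nbhs_nbhs; split => //; exact: chart_dom_open.
  have cont_p : {for p, continuous (chart_map ch)}.
    have := @chart_map_cont _ _ _ ch.
    by rewrite continuous_open_subspace; [apply; rewrite inE|exact: chart_dom_open].
  apply: filterI domp _; apply: cont_p; exact: nbhsx_ballx.
move=> q [qi /= qball].
have [|||l ql lC] := @segment_path i x0 (chart_map ch q) rho K _ _ _ qball.
- by move=> y /ballr /rP[].
- exact: ltW.
- by move=> y a b /ballr /rP[_]; apply.
rewrite !chart_mapK// in ql; exists l => //; apply: le_lt_trans lC _.
have : `|x0 - chart_map ch q| < e / (B + 1).
  by move: qball; rewrite -ball_normE /= lt_min => /andP[].
rewrite ltr_pdivlMr// => xe; apply: le_lt_trans xe.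
by rewrite mulrC ler_wpM2l// lerDl.
Qed.

(** A cluster point of a Cauchy sequence is its limit: concatenate a short path given
by the Cauchy property with a short path given by [short_path_near]. *)
Lemma compact_riem_complete : compact [set: M] -> riem_complete M.
Proof.
move=> cptM s cauchy.
pose F := (s n0 @[n0 --> \oo]).
have [|p [_ clp]] := cptM F _; first exact: filterT.
exists p => e e0.
have e20 : 0 < e / 2 by exact: divr_gt0.
have [N NP] := cauchy (e / 2) e20.
exists N => k Nk.
have [W nW WP] := short_path_near p e20.
have FN : F [set s m | m in [set m | (N <= m)%N]].
  by exists N => // m /= Nm; exists m.
have [_ [[m /= Nm <-] /WP[l pl le2]]] := clp _ _ FN nW.
have /ereal_inf_lt[_ [l' pl' <-]] := NP k m Nk Nm.
rewrite lte_fin => l'e2.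
apply: le_lt_trans (_ : ((l' + l)%:E < e%:E)%E).
  apply: ereal_inf_lbound; exists (l' + l) => //; exact: path_length_cat pl' pl.
by rewrite lte_fin [e]splitr ltrD.
Qed.

End Completeness.

(** * Gram determinants and the pinching theorem *)

Section Gram.
Context {R : realType} {n : nat} (G : 'rV[R]_n -> 'M[R]_n) (x : 'rV[R]_n).
Hypothesis symG : (G x)^T = G x.
Hypothesis posG : forall u : 'rV[R]_n, u != 0 -> 0 < (u *m G x *m u^T) 0 0.

Let gram u v := inner G x u u * inner G x v v - inner G x u v ^+ 2.

Let gC p q : inner G x p q = inner G x q p.
Proof.
rewrite /inner -[p *m G x *m q^T]trmxK [LHS]mxE.
by rewrite !trmx_mul trmxK symG mulmxA.
Qed.

Lemma row_free2P (u v : 'rV[R]_n) :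
  reflect (forall a b, a *: u + b *: v = 0 -> a = 0 /\ b = 0) (row_free (col_mx u v)).
Proof.
rewrite -kermx_eq0; apply: (iffP idP) => [/rowV0P free a b ab0|free].
  have : row_mx a%:M b%:M = 0 :> 'rV_(1 + 1).
    apply: free; apply/sub_kermxP.
    by rewrite mul_row_col !mul_scalar_mx.
  move=> /eqP; rewrite row_mx_eq0 => /andP[/eqP/matrixP/(_ 0 0) + /eqP/matrixP/(_ 0 0)].
  by rewrite !mxE eqxx !mulr1n.
apply/rowV0P => w /sub_kermxP; rewrite -[w]hsubmxK mul_row_col.
rewrite [lsubmx w]mx11_scalar [rsubmx w]mx11_scalar !mul_scalar_mx.
by move=> /free[-> ->]; rewrite raddf0 row_mx0.
Qed.

Lemma gram_row_free u v : gram u v != 0 -> row_free (col_mx u v).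
Proof.
move=> gram0; apply/row_free2P => a b ab0.
have zero p : a * inner G x p u + b * inner G x p v = 0.
  have iL := (inner_bilin G x).2 p.
  by rewrite -(lin1Z iL) -(lin1Z iL) -(lin1D iL) ab0 (lin1_0 iL).
have eu := zero u; have ev := zero v; rewrite (gC v u) in ev.
split; apply: (mulIf gram0); rewrite mul0r /gram.
  transitivity (inner G x v v * (a * inner G x u u + b * inner G x u v)
    - inner G x u v * (a * inner G x u v + b * inner G x v v)); first by ring.
  by rewrite eu ev; ring.
transitivity (inner G x u u * (a * inner G x u v + b * inner G x v v)
  - inner G x u v * (a * inner G x u u + b * inner G x u v)); first by ring.
by rewrite eu ev; ring.
Qed.

Let gram_witness u v :
  inner G x (inner G x u u *: v - inner G x u v *: u) 
            (inner G x u u *: v - inner G x u v *: u) = inner G x u u * gram u v.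
Proof.
have [i1 i2] := inner_bilin G x.
rewrite (lin1B (i1 _)) !(lin1B (i2 _)) !(lin1Z (i1 _)) !(lin1Z (i2 _)) (gC v u).
by rewrite /gram; ring.
Qed.

(** The vector g(u, u) v - g(u, v) u is not zero, and its square norm is the Gram
determinant times g(u, u). *)
Lemma gram_gt0 u v : row_free (col_mx u v) -> 0 < gram u v.
Proof.
move=> /row_free2P free.
have guu : 0 < inner G x u u.
  apply: posG; apply/eqP => u0; have [] := free 1 0.
    by rewrite u0 scaler0 scale0r addr0.
  by move=> /eqP; rewrite oner_eq0.
rewrite -(pmulr_rgt0 _ guu) -gram_witness; apply: posG; apply/eqP => w0.
have [] := free (- inner G x u v) (inner G x u u).
  by rewrite addrC scaleNr.
by move=> _ guu0; move: guu; rewrite guu0 ltxx.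
Qed.

Lemma gram_le0 u v : gram u v <= 0 -> u = 0 \/ exists c, v = c *: u.
Proof.
move=> gram_le0; have [->|u0] := eqVneq u 0; first by left.
right; have guu : 0 < inner G x u u := posG u0.
exists (inner G x u v / inner G x u u).
have [w0|/posG] := eqVneq (inner G x u u *: v - inner G x u v *: u) 0.
  move/eqP: w0; rewrite subr_eq0 => /eqP w0.
  by rewrite mulrC -scalerA -w0 scalerA mulVf ?gt_eqF// scale1r.
by rewrite -/(inner G x _ _) gram_witness pmulr_rgt0// ltNge gram_le0.
Qed.

End Gram.

Theorem theorem1p1 (R : realType) (n : nat) (hn : (2 <= n)%N)
    (M : riemannianManifold R n)
    (Mcompact : compact [set: M]) (Mconnected : connected [set: M])
    (alpha : R) (alpha_gt0 : 0 < alpha) (Meinstein : einstein M alpha)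
    (Mpositive : forall k, sectional_curvatures M k -> 0 < k)
    (delta : R) (delta_gt0 : 0 < delta)
    (delta_attained : sectional_curvatures M delta)
    (delta_lbound : lbound (sectional_curvatures M) delta)
    (delta_pinched : alpha / n%:R < delta) :
  spherical_space_form M.
Proof.
pose Dom i x (xi : chart_img (mfd_chart (s := M) i) x) :=
  PointedOpen (@chart_img_open _ _ _ (mfd_chart (s := M) i)) xi.
have sec_ge i y u v : chart_img (mfd_chart (s := M) i) y ->
    delta * (inner (metric i) y u u * inner (metric i) y v v
             - inner (metric i) y u v ^+ 2) <= curv4 (metric i) y u v v u.
  move=> yi; set gram := _ - _.
  have symG := @Defs.metric_sym _ _ M i y yi.
  have posG w := @metric_posdef _ _ M i y w yi.
  (* The bound by delta extends from planes to all pairs of vectors: on dependent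
     vectors both sides vanish. *)
  have [gram0|gram0] := leP gram 0.
    have [Gi GiG] := metric_mx_inv (D := Dom i y yi) (@metric_smooth _ _ M i)
      (@metric_posdef _ _ M i).
    have cL := curv4_mlin (D := Dom i y yi) (@Defs.metric_sym _ _ M i) GiG yi.
    have cS := curv4_sym (D := Dom i y yi) (@Defs.metric_sym _ _ M i) GiG yi.
    have iL := inner_bilin (metric i) y.
    have [u0|[c vc]] := gram_le0 symG posG gram0.
      have -> : gram = 0 by rewrite /gram u0 !(lin1_0 (iL.1 _)) mul0r expr0n subrr.
      by rewrite mulr0 u0 (lin1_0 (mlin4_1 cL _ _ _)).
    have -> : gram = 0.
      rewrite /gram vc (lin1Z (iL.1 _)) !(lin1Z (iL.2 _)); ring.
    by rewrite mulr0 vc (lin1Z (mlin4_2 cL _ _ _)) (curv_diag12 _ _ _ cS) mulr0.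
  have := delta_lbound (sectional (metric i) y u v).
  rewrite /sectional -/gram ler_pdivlMr//; apply.
  exists i, y, u, v; split => //.
  by apply: (gram_row_free symG); rewrite gt_eqF.
have tau0 : alpha - (n%:R - 1) * delta = 0.
  have [i [x [u [v [xi uv dE]]]]] := delta_attained.
  have symG := @Defs.metric_sym _ _ M i x xi.
  have posG w := @metric_posdef _ _ M i x w xi.
  have gram := gram_gt0 symG posG uv.
  have [Gi GiG] := metric_mx_inv (D := Dom i x xi) (@metric_smooth _ _ M i)
      (@metric_posdef _ _ M i).
  apply: (trace_eq0_at_minimum (D := Dom i x xi) (@Defs.metric_sym _ _ M i)
    (@metric_posdef _ _ M i) (Meinstein i) GiG (fun y u v => @sec_ge i y u v)
    xi gram).
    by rewrite {1}dE /sectional divfK// gt_eqF.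
  (* alpha < n delta is tau < delta. *)
  have n0 : 0 < n%:R :> R by rewrite ltr0n (leq_trans _ hn).
  by move: delta_pinched; rewrite ltr_pdivrMr//; lra.
split => //; first exact: compact_riem_complete.
exists delta => // k [i [x [u [v [xi uv ->]]]]].
have symG := @Defs.metric_sym _ _ M i x xi.
have posG w := @metric_posdef _ _ M i x w xi.
have gram := gram_gt0 symG posG uv.
have [Gi GiG] := metric_mx_inv (D := Dom i x xi) (@metric_smooth _ _ M i)
    (@metric_posdef _ _ M i).
have cE := constant_of_trace0 (D := Dom i x xi) (@Defs.metric_sym _ _ M i)
  (@metric_posdef _ _ M i) (Meinstein i) GiG (fun y u v => @sec_ge i y u v) tau0 u v xi.
rewrite /sectional; apply: (mulIf (lt0r_neq0 gram)).
by rewrite divfK ?gt_eqF.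
Qed.
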